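(* Let $G$ be any undirected graph on $[d]=\{1,\dots,d\}$. The set of positive definite matrices $A\in\mathbb{R}^{d\times d}$ for which $\Sigma=A^{-1}$ is Markovian with respect to $G$ but not perfect with respect to $G$ has Lebesgue measure zero, where the Lebesgue measure is of dimension $|G|+d$.
   Context: Graphs are undirected, on vertex set $[d]$, without self-loops; $|G|$ denotes the number of edges of $G$. For disjoint $A,B,C\subset[d]$, $C$ separates $A$ from $B$ in $G$ if every path in $G$ (sequence of distinct, consecutively adjacent vertices) from a vertex of $A$ to a vertex of $B$ contains a vertex of $C$. Positive definite means symmetric positive definite. A positive definite matrix $\Sigma\in\mathbb{R}^{d\times d}$ is Markovian with respect to $G$ if the support of $\Sigma^{-1}$ is exactly $G$ with all self-loops added, i.e. for $i\neq j$, $(\Sigma^{-1})_{i,j}\neq 0$ if and only if $\{i,j\}$ is an edge of $G$. $\Sigma$ is perfect with respect to $G$ if, for $X=(X_1,\dots,X_d)\sim N(0,\Sigma)$ and all disjoint $A,B,C\subset[d]$ with $A,B$ nonempty ($C$ may be empty): $C$ separates $A$ from $B$ in $G$ if and only if $X_A$ and $X_B$ are conditionally independent given $X_C$, where $X_S=\{X_i: i\in S\}$. A symmetric matrix $A$ whose off-diagonal entries vanish outside the edges of $G$ is identified with the vector in $\mathbb{R}^{|G|+d}$ consisting of its $d$ diagonal entries and its $|G|$ entries indexed by the (unordered) edges of $G$; the Lebesgue measure is that of $\mathbb{R}^{|G|+d}$. *)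

(* Defs.v *)
From HB Require Import structures.
From mathcomp Require Import all_boot all_order all_algebra.
From mathcomp Require Import all_classical all_reals all_analysis.

Set Implicit Arguments.
Unset Strict Implicit.
Unset Printing Implicit Defensive.

Import Order.TTheory GRing.Theory Num.Theory.
Import numFieldNormedType.Exports.

Local Open Scope classical_set_scope.
Local Open Scope ring_scope.

(** * Lebesgue measure on R^n

    R^n is [n.-tuple R] with its product sigma-algebra.  Its Lebesgue measure
    is the image of the product of [lebesgue_measure] and the Lebesgue measure
    on R^(n-1) under [(x, t) |-> x :: t]; [lebesgue_tuple_box] characterizes
    it by its values on boxes. *)

Section lebesgue_tuple.
Context {R : realType}.
Local Open Scope ereal_scope.

Definition tcons n (p : measurableTypeR R * n.-tuple R) : n.+1.-tuple R :=
  [tuple of (p.1 : R) :: p.2].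

Lemma measurable_tcons n : measurable_fun setT (@tcons n).
Proof.
apply: (@measurable_cons _ _ _ R (fst : measurableTypeR R * n.-tuple R -> R)
  n snd).
  exact: measurable_fst.
exact: measurable_snd.
Qed.

Section cons_measure.
Variables (n : nat) (mu : {sigma_finite_measure set (n.-tuple R) -> \bar R}).

Definition cons_measure : set (n.+1.-tuple R) -> \bar R :=
  pushforward (lebesgue_measure \x mu) (@tcons n).

Let cons_measure0 : cons_measure set0 = 0.
Proof. by rewrite /cons_measure /pushforward preimage_set0 measure0. Qed.

Let cons_measure_ge0 A : 0 <= cons_measure A.
Proof. by rewrite /cons_measure /pushforward; exact: measure_ge0. Qed.

Let measurable_preimage_tcons (A : set (n.+1.-tuple R)) :
  measurable A -> measurable (@tcons n @^-1` A).
Proof. by move=> mA; rewrite -[X in measurable X]setTI; exact: measurable_tcons. Qed.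

Let cons_measure_sigma_additive : semi_sigma_additive cons_measure.
Proof.
move=> F mF tF mUF; rewrite /cons_measure /pushforward preimage_bigcup.
apply: measure_semi_sigma_additive.
- by move=> i; exact: measurable_preimage_tcons.
- apply/trivIsetP => /= i j _ _ ij; rewrite -preimage_setI.
  by move/trivIsetP : tF => /(_ _ _ _ _ ij) ->//; rewrite preimage_set0.
- by rewrite -preimage_bigcup; exact: measurable_preimage_tcons.
Qed.

HB.instance Definition _ := isMeasure.Build _ _ _ cons_measure
  cons_measure0 cons_measure_ge0 cons_measure_sigma_additive.

Lemma cons_measure_box (A : set R) (B : set (n.-tuple R)) :
  measurable A -> measurable B ->
  cons_measure [set t | A (thead t) /\ B [tuple of behead t]] =
  lebesgue_measure A * mu B.
Proof.
move=> mA mB; rewrite -product_measure1E//.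
congr (product_measure1 _ _ _).
have E (p : measurableTypeR R * n.-tuple R) : [tuple of behead (tcons p)] = p.2.
  exact: val_inj.
by apply/seteqP; split => p /=; rewrite theadE E.
Qed.

Lemma measurable_box_cons (A : set R) (B : set (n.-tuple R)) :
  measurable A -> measurable B ->
  measurable [set t : n.+1.-tuple R | A (thead t) /\ B [tuple of behead t]].
Proof.
move=> mA mB; apply: (@measurableI _ _ [set t | A (thead t)]
    [set t : n.+1.-tuple R | B [tuple of behead t]]).
  by rewrite -[X in measurable X]setTI; exact: (@measurable_tnth _ R n.+1 ord0).
by rewrite -[X in measurable X]setTI; exact: measurable_behead.
Qed.

Let cons_measure_sigma_finite : sigma_finite setT cons_measure.
Proof.
have /sigma_finiteP[F [TF ndF Foo]] := sigma_finiteT (@lebesgue_measure R).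
have /sigma_finiteP[G [TG ndG Goo]] := sigma_finiteT mu.
exists (fun k => [set t | F k (thead t) /\ G k [tuple of behead t]]).
  apply/seteqP; split => // t _.
  have [i _ Fi] : (\bigcup_i F i) (thead t) by rewrite -TF.
  have [j _ Gj] : (\bigcup_i G i) [tuple of behead t] by rewrite -TG.
  exists (maxn i j) => //; split.
  - by move: Fi; exact/subsetPset/ndF/leq_maxl.
  - by move: Gj; exact/subsetPset/ndG/leq_maxr.
move=> k; have [mF Fk] := Foo k; have [mG Gk] := Goo k; split.
  exact: measurable_box_cons.
by rewrite cons_measure_box// lte_mul_pinfty// ge0_fin_numE.
Qed.

HB.instance Definition _ := Measure_isSigmaFinite.Build _ _ _ cons_measure
  cons_measure_sigma_finite.

End cons_measure.

Fixpoint lebesgue_tuple (n : nat) :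
    {sigma_finite_measure set (n.-tuple R) -> \bar R} :=
  match n with
  | 0 => @dirac _ _ [tuple] R
  | m.+1 => cons_measure (lebesgue_tuple m)
  end.

Lemma measurable_box n (I : 'I_n -> set R) :
  (forall i, measurable (I i)) ->
  measurable [set t : n.-tuple R | forall i, I i (tnth t i)].
Proof.
move=> mI.
rewrite [X in measurable X](_ : _ =
    \bigcap_(i in [set: 'I_n]) [set t : n.-tuple R | I i (tnth t i)]); last first.
  by apply/seteqP; split => t /= It i; [move=> _; exact: It|exact: (It i)].
apply: fin_bigcap_measurable => // i _.
by rewrite -[X in measurable X]setTI; exact: (@measurable_tnth _ R n i).
Qed.

Lemma lebesgue_tuple_box n (I : 'I_n -> set R) :
  (forall i, measurable (I i)) ->
  lebesgue_tuple n [set t | forall i, I i (tnth t i)] =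
  \prod_(i < n) lebesgue_measure (I i).
Proof.
elim: n I => [|n ih] I mI.
  by rewrite big_ord0 /= diracE mem_set//; case.
rewrite big_ord_recl -ih// -cons_measure_box//; last first.
  by apply: (@measurable_box n (fun i => I (lift ord0 i))) => i; exact: mI.
congr (cons_measure _ _); apply/seteqP; split => t /=.
  move=> It; split => [|i]; first exact: It.
  by rewrite (tuple_eta t) in It; have := It (lift ord0 i); rewrite tnthS.
move=> [It0 It] i; case: (unliftP ord0 i) => [j ->|->]; last exact: It0.
by rewrite (tuple_eta t) tnthS; exact: It.
Qed.

End lebesgue_tuple.

Definition positive_definite {R : realType} d (A : 'M[R]_d) : Prop :=
  A^T = A /\ forall u : 'rV[R]_d, u != 0 -> 0 < (u *m A *m u^T) 0 0.

(** * Conditional independence of sub-sigma-algebras *)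

Section conditional_independence.
Context d (T : measurableType d) {R : realType} (P : probability T R).

(** [f] is a version of the conditional probability P(E | F). *)
Definition is_cond_prob (F : set (set T)) (E : set T) (f : T -> R) : Prop :=
  [/\ forall B : set R, measurable B -> F (f @^-1` B),
      P.-integrable setT (EFin \o f) &
      forall D, F D -> (\int[P]_(t in D) (f t)%:E = P (E `&` D))%E].

(** P(E1 & E2 | F) = P(E1 | F) P(E2 | F) almost surely.  Versions of a
    conditional probability exist (Radon-Nikodym) and agree almost surely, so
    quantifying existentially over them loses nothing. *)
Definition cond_indep (F1 F2 F : set (set T)) : Prop :=
  forall E1 E2, F1 E1 -> F2 E2 ->
  exists f1 f2 f12 : T -> R,
    [/\ is_cond_prob F E1 f1, is_cond_prob F E2 f2,
        is_cond_prob F (E1 `&` E2) f12 &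
        {ae P, forall t, f12 t = f1 t * f2 t}].

End conditional_independence.

Section gaussian.
Context {R : realType} (d : nat).

Definition gaussian_pdf (S : 'M[R]_d) (x : d.-tuple R) : R :=
  let v := \row_(i < d) tnth x i in
  (Num.sqrt ((2 * pi) ^+ d * \det S))^-1 *
  expR (- (v *m invmx S *m v^T) 0 0 / 2).

(** X ~ N(0, S), for S positive definite. *)
Definition is_gaussian d0 (T : measurableType d0) (P : probability T R)
    (X : {RV P >-> d.-tuple R}) (S : 'M[R]_d) : Prop :=
  forall E : set (d.-tuple R), measurable E ->
    (distribution P X E =
     \int[lebesgue_tuple d]_(x in E) (gaussian_pdf S x)%:E)%E.

(** The sigma-algebra generated by the subfamily (X_i)_(i in A); it is trivial
    when A is empty. *)
Definition sigma_coord d0 (T : measurableType d0) (X : T -> d.-tuple R)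
    (A : {set 'I_d}) : set (set T) :=
  <<s \bigcup_(i in [set i | i \in A])
        preimage_set_system setT (fun t => tnth (X t) i) measurable >>.

End gaussian.

(** * Graphs on 'I_d, given by a (symmetric, irreflexive) adjacency relation *)

Section graph.
Context (d : nat) (G : rel 'I_d).

Definition separates (C A B : {set 'I_d}) : Prop :=
  forall (x : 'I_d) (p : seq 'I_d),
    path G x p -> uniq (x :: p) -> x \in A -> last x p \in B ->
    has (mem C) (x :: p).

(** Each undirected edge {i, j} is represented once, by (i, j) with i < j. *)
Definition edges : {set 'I_d * 'I_d} :=
  [set e : 'I_d * 'I_d | (e.1 < e.2)%N && G e.1 e.2]%SET.

Context {R : realType}.
Implicit Types S A : 'M[R]_d.

Definition markovian S : Prop :=
  positive_definite S /\
  forall i j : 'I_d, i != j -> (invmx S i j != 0) = G i j.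

(** Conditional independence depends only on the law of X, so all realizations
    X ~ N(0, S) satisfy the condition as soon as one does. *)
Definition perfect S : Prop :=
  forall d0 (T : measurableType d0) (P : probability T R)
    (X : {RV P >-> d.-tuple R}), is_gaussian X S ->
  forall A B C : {set 'I_d},
    ([disjoint A & B])%B -> ([disjoint A & C])%B -> ([disjoint B & C])%B ->
    A != finset.set0 -> B != finset.set0 ->
    separates C A B <->
    cond_indep P (sigma_coord X A) (sigma_coord X B) (sigma_coord X C).

(** The vector of R^(|G| + d) identified with a symmetric matrix supported on
    G: its entries at the edges of G, then its diagonal entries. *)
Definition coordinates A : (#|edges| + d).-tuple R :=
  [tuple of [tuple A (enum_val k).1 (enum_val k).2 | k < #|edges|] ++
            [tuple A i i | i < d]].

End graph.

(* Main.v *)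
Require Import Defs.
From HB Require Import structures.
From mathcomp Require Import all_boot all_order all_algebra.
From mathcomp Require Import all_classical all_reals all_analysis.
From mathcomp Require Import measurable_realfun ring lra.

Set Implicit Arguments.
Unset Strict Implicit.
Unset Printing Implicit Defensive.

Import Order.TTheory GRing.Theory Num.Theory.
Import numFieldNormedType.Exports.

Local Open Scope classical_set_scope.
Local Open Scope ring_scope.

(** Write [K] for a positive definite matrix supported on [G] and [p] for the
    density of N(0, K^-1), a multiple of exp (- x K x^T / 2).

    Separation implies conditional independence for every such [K]
    ([separates_cond_indep]).  If [C] separates [A] from [B], split the vertices
    outside [C] into the set [A'] of those reachable from [A] off [C] and the
    rest [B'].  No edge joins [A'] to [B'], so the quadratic form is a sum, and
    [p] a product, of two functions that share the variables in [C] only, and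
    the conditional probabilities given [X_C] factor ([cond_indep_factor]).

    Conversely, suppose that [X_a] and [X_b] are conditionally independent given
    [X_C].  The joint density [h] of [X_a], [X_b], [X_C] then equals
    p_aC * p_bC / p_C, where the factors are marginal densities: both functions
    are continuous and have the same integrals over boxes
    ([eq_of_integrate_box]).  Marginals of Gaussian densities are Gaussian, and
    integrating out one coordinate is a step of Gaussian elimination on the
    precision matrix ([int1_gform], [integrate_gform]).  Comparing the
    coefficients of x_a * x_b shows that the Schur complement of [K] for the
    coordinates outside [a], [b], [C] vanishes at (a, b); equivalently, the
    (a, b) cofactor of the block of [K] off [C] is 0 ([cond_indep_adj0]).

    This cofactor is a polynomial in the coordinates of [K].  When a path joins
    [a] to [b] off [C], it is not the zero polynomial: for (d + 1) I minus the
    adjacency matrix, the minimum principle makes the inverse of the block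
    positive at (a, b) ([minimum_principle_adj], [minor_fun_neq0]).  The zero
    set of a nonzero polynomial is Lebesgue-null ([polyfun_null]), and a
    matrix that is Markovian but not perfect lies in one of these finitely many
    null sets, one for each choice of [a], [b] and [C].

    All the integrals are computed by [integrate s], which integrates a function
    on R^d over the coordinates listed in [s] and keeps it a function on R^d:
    marginal and conditional densities then live on the same space as [p], and
    Tonelli's theorem says that the order of [s] is irrelevant. *)

(** * Integrating out some coordinates *)

Section partial_integration.
Context {R : realType} (n : nat).
Implicit Types (x y : n.-tuple R) (f g h : n.-tuple R -> \bar R).
Implicit Types (i j : 'I_n) (s : seq 'I_n) (A B C : {set 'I_n}).

Definition upd x i (r : R) : n.-tuple R :=
  [tuple if j == i then r else tnth x j | j < n].

Lemma tnth_upd x i r j : tnth (upd x i r) j = if j == i then r else tnth x j.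
Proof. by rewrite tnth_mktuple. Qed.

Lemma upd_swap x i j r t : i != j ->
  upd (upd x i r) j t = upd (upd x j t) i r.
Proof.
move=> ij; apply: eq_from_tnth => k; rewrite !tnth_upd.
by case: (k =P j) => [->|//]; rewrite eq_sym (negbTE ij).
Qed.

Lemma measurable_upd_pair i :
  measurable_fun setT (fun p : n.-tuple R * R => upd p.1 i p.2).
Proof.
apply/measurable_fun_tnthP => j.
rewrite (_ : _ \o _ = fun p : n.-tuple R * R =>
    if j == i then p.2 else tnth p.1 j); last first.
  by apply/funext => p /=; rewrite tnth_upd.
case: (j == i); first exact: measurable_snd.
apply: (@measurableT_comp _ _ _ _ _ _ (fun x : n.-tuple R => tnth x j)) => //.
exact: measurable_tnth.
Qed.

Lemma measurable_upd x i : measurable_fun setT (upd x i).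
Proof.
apply/measurable_fun_tnthP => j.
rewrite (_ : _ \o _ = fun r : R => if j == i then r else tnth x j); last first.
  by apply/funext => p /=; rewrite tnth_upd.
by case: (j == i).
Qed.

Definition int1 i f x : \bar R := (\int[lebesgue_measure]_r f (upd x i r))%E.

Definition integrate s f : n.-tuple R -> \bar R := foldr int1 f s.

(** The hypotheses of Tonelli's theorem. *)
Definition mpos f := measurable_fun [set: n.-tuple R] f /\ forall x, (0 <= f x)%E.

Lemma mposM f g : mpos f -> mpos g -> mpos (fun x => f x * g x)%E.
Proof.
move=> [mf f0] [mg g0]; split; first exact: emeasurable_funM.
by move=> x; rewrite mule_ge0.
Qed.

Lemma mpos_cst (k : \bar R) : (0 <= k)%E -> mpos (fun=> k).
Proof. by move=> k0; split. Qed.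

Lemma mpos_EFin (f : n.-tuple R -> R) :
  measurable_fun setT f -> (forall x, 0 <= f x) -> mpos (EFin \o f).
Proof. by move=> mf f0; split; [exact/measurable_EFinP|move=> x; rewrite lee_fin]. Qed.

Lemma mpos_indic (E : set (n.-tuple R)) : measurable E ->
  mpos (fun x => (\1_E x)%:E).
Proof. by move=> mE; apply: mpos_EFin. Qed.

Lemma mpos_upd f x i : mpos f -> measurable_fun setT (fun r => f (upd x i r)).
Proof. by move=> [mf _]; apply: measurableT_comp => //; exact: measurable_upd. Qed.

Lemma mpos_int1 i f : mpos f -> mpos (int1 i f).
Proof.
move=> [mf f0]; split; last by move=> x; apply: integral_ge0.
apply: (@measurable_fun_fubini_tonelli_F _ _ _ _ _ lebesgue_measure
  (fun p : n.-tuple R * R => f (upd p.1 i p.2))) => //.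
by apply: measurableT_comp => //; exact: measurable_upd_pair.
Qed.

Lemma mpos_integrate s f : mpos f -> mpos (integrate s f).
Proof. by move=> pf; elim: s => //= i s; exact: mpos_int1. Qed.

Lemma eq_integrate s f g : f =1 g -> integrate s f =1 integrate s g.
Proof. by move=> /funext ->. Qed.

Lemma integrate_cat s1 s2 f :
  integrate (s1 ++ s2) f = integrate s1 (integrate s2 f).
Proof. exact: foldr_cat. Qed.

Lemma int1_swap i j f : mpos f -> int1 i (int1 j f) = int1 j (int1 i f).
Proof.
have [->//|ij] := eqVneq i j.
move=> [mf f0]; apply/funext => x.
pose F (p : R * R) := f (upd (upd x i p.1) j p.2).
have mF : measurable_fun [set: R * R] F.
  apply: (measurableT_comp mf); apply/measurable_fun_tnthP => k.
  rewrite (_ : _ \o _ = fun p : R * R =>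
      if k == j then p.2 else if k == i then p.1 else tnth x k); last first.
    by apply/funext => p /=; rewrite !tnth_upd.
  case: (k == j); first exact: measurable_snd.
  by case: (k == i); first exact: measurable_fst.
have F0 p : (0 <= F p)%E by exact: f0.
have := @fubini_tonelli _ _ _ _ _ lebesgue_measure lebesgue_measure F mF F0.
rewrite /F /int1 /= => ->.
by apply: eq_integral => t _; apply: eq_integral => r _; rewrite upd_swap.
Qed.

Lemma int1_integrate i s f : mpos f ->
  int1 i (integrate s f) = integrate s (int1 i f).
Proof.
move=> pf; elim: s => //= j s <-; rewrite int1_swap//.
exact: mpos_integrate.
Qed.

(** Tonelli's theorem, in the form in which it is used throughout. *)
Lemma perm_integrate s1 s2 f : mpos f -> perm_eq s1 s2 ->
  integrate s1 f = integrate s2 f.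
Proof.
move=> pf; elim: s1 s2 => [|i s1 IH] s2.
  by rewrite perm_sym => /perm_nilP ->.
move=> p; have is2 : i \in s2 by rewrite -(perm_mem p) mem_head.
case/splitPr: is2 p => s3 s4 p.
have p' : perm_eq s1 (s3 ++ s4).
  by rewrite -(perm_cons i); apply: (perm_trans p); rewrite -cat1s perm_catCA.
rewrite /= (IH _ p') !integrate_cat /= int1_integrate//.
exact: mpos_integrate.
Qed.

Definition depends_on (T : Type) C (f : n.-tuple R -> T) :=
  forall x y, (forall i, i \in C -> tnth x i = tnth y i) -> f x = f y.

Lemma depends_onS (T : Type) C B (f : n.-tuple R -> T) :
  C \subset B -> depends_on C f -> depends_on B f.
Proof. by move=> /fintype.subsetP CB df x y xy; apply: df => i /CB/xy. Qed.

Lemma depends_on_upd (T : Type) C (f : n.-tuple R -> T) i x r :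
  depends_on C f -> i \notin C -> f (upd x i r) = f x.
Proof.
move=> df iC; apply: df => j jC; rewrite tnth_upd.
by case: eqP jC iC => // -> ->.
Qed.

Lemma depends_on2 (T1 T2 T : Type) C (f : n.-tuple R -> T1)
    (g : n.-tuple R -> T2) (h : T1 -> T2 -> T) :
  depends_on C f -> depends_on C g -> depends_on C (fun x => h (f x) (g x)).
Proof. by move=> df dg x y xy; rewrite (df x y)// (dg x y). Qed.

Lemma depends_on_comp (T1 T : Type) C (f : n.-tuple R -> T1) (h : T1 -> T) :
  depends_on C f -> depends_on C (fun x => h (f x)).
Proof. by move=> df x y xy; rewrite (df x y). Qed.

Lemma depends_on_int1 C i f :
  depends_on (i |: C) f -> depends_on C (int1 i f).
Proof.
move=> df x y xy; apply: eq_integral => r _; apply: df => j.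
rewrite !tnth_upd !inE; case: (j =P i) => //= _; exact: xy.
Qed.

Lemma depends_on_integrate s C f :
  depends_on ([set i | i \in s] :|: C)%SET f -> depends_on C (integrate s f).
Proof.
elim: s C => [|i s IH] C df /=.
  by apply: depends_onS df; apply/fintype.subsetP => j; rewrite !inE.
apply: depends_on_int1; apply: IH; apply: depends_onS df.
by apply/fintype.subsetP => j; rewrite !inE orbA (orbC (j \in s)) => /orP[/orP[]|] ->;
  rewrite ?orbT.
Qed.

Lemma integrateZ s C h f x : mpos f -> mpos h -> depends_on C h ->
  (forall i, i \in s -> i \notin C) ->
  (integrate s (fun y => h y * f y) x = h x * integrate s f x)%E.
Proof.
move=> pf ph dh; elim: s x => //= i s IH x sC; rewrite /int1.
have iC : i \notin C by apply: sC; rewrite mem_head.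
under eq_integral => r _.
  rewrite IH; last by move=> j js; apply: sC; rewrite inE js orbT.
  rewrite (depends_on_upd _ _ dh iC).
  over.
have pg := mpos_integrate s pf.
rewrite ge0_integralZl//; first exact: mpos_upd.
- by move=> r _; apply: pg.2.
- exact: ph.2.
Qed.

Lemma le_integrate s f g : mpos f -> mpos g -> (forall x, f x <= g x)%E ->
  forall x, (integrate s f x <= integrate s g x)%E.
Proof.
move=> pf pg fg; elim: s => //= i s IH x.
have [mf f0] := mpos_integrate s pf; have [mg g0] := mpos_integrate s pg.
by apply: ge0_le_integral => //; exact: mpos_upd.
Qed.

(** If the integral of a positive function were 0, the function would vanish
    almost everywhere, so the whole line would be null. *)
Lemma int1_gt0 i f x : mpos f -> (forall x, 0 < f x)%E -> (0 < int1 i f x)%E.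
Proof.
move=> pf f0; rewrite lt0e (mpos_int1 i pf).2 andbT; apply/negP => /eqP f1.
have : ae_eq lebesgue_measure setT (fun r => f (upd x i r)) (cst 0%E).
  apply/ae_eq_integral_abs => //; first exact: mpos_upd.
  by rewrite -[RHS]f1; apply: eq_integral => r _; rewrite gee0_abs// ltW.
move=> [N [mN N0]]; have -> : ~` (fun r => setT r -> f (upd x i r) = cst 0%E r) = setT.
  by apply/seteqP; split => // r _ /(_ I) /= e; have := f0 (upd x i r); rewrite e ltxx.
move=> TN; have NT : N = setT by apply/seteqP; split.
have : (lebesgue_measure (`[0%R, 1%R] : set R) <= lebesgue_measure N)%E.
  by apply: le_measure; rewrite ?inE ?NT.
rewrite N0 lebesgue_measure_itv /= lte01 oppr0 adde0.
by rewrite lee_fin ler10.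
Qed.

Lemma integrate_gt0 s f : mpos f -> (forall x, 0 < f x)%E ->
  forall x, (0 < integrate s f x)%E.
Proof.
move=> pf f0; elim: s => //= i s IH x; apply: int1_gt0 => //.
exact: mpos_integrate.
Qed.

End partial_integration.

Section lebesgue_tuple_integral.
Context {R : realType}.
Local Open Scope ereal_scope.

Lemma integral_tcons n (mu : {sigma_finite_measure set (n.-tuple R) -> \bar R})
    (f : n.+1.-tuple R -> \bar R) : mpos f ->
  \int[cons_measure mu]_x f x =
  \int[lebesgue_measure]_r \int[mu]_t f (tcons (r, t)).
Proof.
move=> [mf f0].
have mF : measurable_fun setT (f \o @tcons R n).
  by apply: measurableT_comp => //; exact: measurable_tcons.
have F0 p : 0 <= (f \o @tcons R n) p by exact: f0.
have <- := @fubini_tonelli1 _ _ _ _ _ lebesgue_measure mu _ mF F0.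
have := @ge0_integral_pushforward _ _ _ _ R _ (@measurable_tcons R n)
  (lebesgue_measure \x mu) _ _ measurableT mf.
by rewrite preimage_setT; apply => ? _; exact: f0.
Qed.

Lemma tcons_tuple_eta n (x : n.+1.-tuple R) :
  x = tcons (thead x, [tuple of behead x]).
Proof. exact: tuple_eta. Qed.

Lemma tnth_tconsS n (r : R) (t : n.-tuple R) i :
  tnth (tcons (r, t)) (lift ord0 i) = tnth t i.
Proof. exact: tnthS. Qed.

Lemma upd_tcons0 n (r u : R) (t : n.-tuple R) :
  upd (tcons (r, t)) ord0 u = tcons (u, t).
Proof.
apply: eq_from_tnth => j; rewrite tnth_upd.
by case: (unliftP ord0 j) => [i ->|->//]; rewrite !tnth_tconsS.
Qed.

Lemma upd_tconsS n (r u : R) (t : n.-tuple R) i :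
  upd (tcons (r, t)) (lift ord0 i) u = tcons (r, upd t i u).
Proof.
apply: eq_from_tnth => j; rewrite tnth_upd.
case: (unliftP ord0 j) => [k ->|->//].
by rewrite !tnth_tconsS tnth_upd (inj_eq lift_inj).
Qed.

Lemma mpos_tcons n (f : n.+1.-tuple R -> \bar R) (r : R) :
  mpos f -> mpos (fun t => f (tcons (r, t))).
Proof.
move=> [mf f0]; split => //; apply: (measurableT_comp mf).
apply: (measurableT_comp (@measurable_tcons R n)).
exact: measurable_fun_pair.
Qed.

Lemma integrate_lift n (f : n.+1.-tuple R -> \bar R) s (r : R) (t : n.-tuple R) :
  integrate [seq lift ord0 i | i <- s] f (tcons (r, t)) =
  integrate s (fun t => f (tcons (r, t))) t.
Proof.
elim: s t => //= i s IH t; apply: eq_integral => u _.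
by rewrite upd_tconsS IH.
Qed.

(** Tonelli's theorem: the Lebesgue integral over R^n integrates out all the
    coordinates, so the result does not depend on the base point [x]. *)
Lemma integral_lebesgue_tuple n (f : n.-tuple R -> \bar R) x : mpos f ->
  \int[lebesgue_tuple n]_y f y = integrate (enum 'I_n) f x.
Proof.
elim: n f x => [|n IH] f x pf.
  have -> : enum 'I_0 = [::] by apply/size0nil; rewrite size_enum_ord.
  rewrite /= integral_dirac ?diracT ?mul1e//=; last by case: pf.
  by rewrite (tuple0 x).
rewrite /= integral_tcons// enum_ordSl /=.
apply: eq_integral => r _.
rewrite (tcons_tuple_eta x) upd_tcons0 integrate_lift.
exact: (IH _ _ (mpos_tcons r pf)).
Qed.

Lemma integral_lebesgue_tuple_setC n (C : {set 'I_n})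
    (f : n.-tuple R -> \bar R) x : mpos f ->
  \int[lebesgue_tuple n]_y f y =
  integrate (enum C) (integrate (enum (~: C)%SET) f) x.
Proof.
move=> pf; rewrite (integral_lebesgue_tuple x pf) -integrate_cat.
rewrite (@perm_integrate _ _ (enum 'I_n) (enum C ++ enum (~: C)%SET))//.
apply: uniq_perm; first exact: enum_uniq.
  rewrite cat_uniq !enum_uniq /= andbT; apply/hasPn => i.
  by rewrite !mem_enum inE.
by move=> i; rewrite mem_cat !mem_enum !inE orbN.
Qed.

End lebesgue_tuple_integral.

(** * Gaussian densities and Gaussian elimination *)

Section gaussian_form.
Context {R : realType} (d : nat).
Implicit Types (x y : d.-tuple R) (S : 'M[R]_d) (i j : 'I_d) (s : seq 'I_d).

Definition row_of x : 'rV[R]_d := \row_(i < d) tnth x i.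

Definition qform S x : R := (row_of x *m S *m (row_of x)^T) 0 0.

Definition gform (k : R) S x : R := k * expR (- qform S x / 2).

Lemma qformE S x :
  qform S x = \sum_i \sum_j tnth x i * S i j * tnth x j.
Proof.
rewrite /qform mxE exchange_big /=; apply: eq_bigr => j _.
by rewrite !mxE mulr_suml; apply: eq_bigr => i _; rewrite mxE.
Qed.

Lemma qformD S1 S2 x : qform (S1 + S2) x = qform S1 x + qform S2 x.
Proof. by rewrite /qform mulmxDr mulmxDl mxE. Qed.

Lemma qformN S x : qform (- S) x = - qform S x.
Proof. by rewrite /qform mulmxN mulNmx mxE. Qed.

Lemma depends_on_qform S (C : {set 'I_d}) : S^T = S ->
  (forall i j, i \notin C -> S i j = 0) -> depends_on C (qform S).
Proof.
move=> symS S0 x y xy; rewrite !qformE; apply: eq_bigr => i _.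
apply: eq_bigr => j _; have [iC|iC] := boolP (i \in C); last first.
  by rewrite S0// !mulr0 !mul0r.
have [jC|jC] := boolP (j \in C); first by rewrite !xy.
by rewrite -symS mxE S0// !mulr0 !mul0r.
Qed.

Lemma depends_on_gform (k : R) S (C : {set 'I_d}) : S^T = S ->
  (forall i j, i \notin C -> S i j = 0) -> depends_on C (gform k S).
Proof.
by move=> symS S0 x y xy; rewrite /gform (depends_on_qform symS S0 xy).
Qed.

Lemma measurable_qform S : measurable_fun setT (qform S).
Proof.
rewrite (_ : qform S =
    fun x => \sum_i \sum_j tnth x i * S i j * tnth x j); last first.
  by apply/funext => x; rewrite qformE.
apply: measurable_sum => i; apply: measurable_sum => j.
apply: measurable_funM; first apply: measurable_funM => //.
  exact: measurable_tnth.
exact: measurable_tnth.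
Qed.

Lemma measurable_gform (k : R) S : measurable_fun setT (gform k S).
Proof.
apply: measurable_funM => //; apply: measurableT_comp => //.
apply: measurable_funM => //; apply: measurableT_comp => //.
exact: measurable_qform.
Qed.

Lemma gform_gt0 (k : R) S x : 0 < k -> 0 < gform k S x.
Proof. by move=> k0; rewrite mulr_gt0 ?expR_gt0. Qed.

Lemma mpos_gform (k : R) S : 0 < k -> mpos (EFin \o gform k S).
Proof.
by move=> k0; apply: mpos_EFin (measurable_gform _ _) _ => x; exact/ltW/gform_gt0.
Qed.

Definition elim_mx i S : 'M[R]_d := S - (S i i)^-1 *: (col i S *m row i S).

Lemma elim_mxE i S j k : elim_mx i S j k = S j k - S j i * S i k / S i i.
Proof. by rewrite !mxE big_ord1 !mxE; ring. Qed.

Lemma elim_mx_sym i S : S^T = S -> (elim_mx i S)^T = elim_mx i S.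
Proof.
move=> symS; apply/matrixP => j k; rewrite mxE !elim_mxE.
have E a b : S a b = S b a by rewrite -{1}symS mxE.
by rewrite (E k j) (E k i) (E i j) (mulrC (S i k)).
Qed.

Lemma qform_elim i S x : S^T = S ->
  qform (elim_mx i S) x = qform S x - (row_of x *m S) 0 i ^+ 2 / S i i.
Proof.
move=> symS; rewrite /elim_mx qformD qformN; congr (_ - _).
rewrite /qform -scalemxAr -scalemxAl mxE (mulmxA (row_of x)).
rewrite -(mulmxA (row_of x *m _)) mxE big_ord1.
have -> : (row_of x *m col i S) 0 0 = (row_of x *m S) 0 i.
  by rewrite !mxE; apply: eq_bigr => j _; rewrite !mxE.
have -> : (row i S *m (row_of x)^T) 0 0 = (row_of x *m S) 0 i.
  rewrite !mxE; apply: eq_bigr => j _.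
  by rewrite !mxE -{1}symS mxE mulrC.
by rewrite -expr2 mulrC.
Qed.

Lemma row_of_upd_mul S x i (r : R) :
  (row_of (upd x i r) *m S) 0 i =
  (row_of x *m S) 0 i + S i i * (r - tnth x i).
Proof.
rewrite !mxE (bigD1 i)//= [in RHS](bigD1 i)//= !mxE tnth_upd eqxx.
rewrite [in LHS](eq_bigr (fun j => row_of x 0 j * S j i)); first by ring.
by move=> j ji; rewrite !mxE tnth_upd (negbTE ji).
Qed.

(** Completing the square in the coordinate [i]. *)
Lemma qform_upd S x i (r : R) : S^T = S -> S i i != 0 ->
  qform S (upd x i r) = qform (elim_mx i S) x +
    S i i * (r - (tnth x i - (row_of x *m S) 0 i / S i i)) ^+ 2.
Proof.
move=> symS Sii; have symE := elim_mx_sym i symS.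
have dE : depends_on [set~ i] (qform (elim_mx i S)).
  apply: depends_on_qform => // j k; rewrite !inE negbK => /eqP ->.
  by rewrite elim_mxE mulrAC divff// mul1r subrr.
rewrite -[in RHS](@depends_on_upd _ _ _ _ _ i x r dE) ?inE ?eqxx//.
rewrite qform_elim// row_of_upd_mul; field.
by [].
Qed.

(** Up to a constant, the integrand is the density of a normal law of mean [m]
    and variance 1 / a; its mass does not depend on [m]. *)
Lemma integral_gauss_square (a : R) : 0 < a ->
  exists2 c : R, 0 < c & forall m : R,
    (\int[lebesgue_measure]_r (expR (- (a * (r - m) ^+ 2) / 2))%:E = c%:E)%E.
Proof.
move=> a0; pose sg := Num.sqrt a^-1.
have sg0 : sg != 0 by rewrite gt_eqF// sqrtr_gt0 invr_gt0.
have pk0 := normal_peak_gt0 sg0.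
exists (normal_peak sg)^-1 => [|m]; first by rewrite invr_gt0.
rewrite -[RHS]mule1 -(integral_normal_pdf m sg) -ge0_integralZl//; last 3 first.
- by apply/measurable_EFinP; exact: measurable_normal_pdf.
- by move=> r _; rewrite lee_fin normal_pdf_ge0.
- by rewrite lee_fin invr_ge0 ltW.
apply: eq_integral => r _; rewrite -EFinM normal_pdfE// mulKf ?gt_eqF//.
congr (expR _)%:E; rewrite sqr_sqrtr ?invr_ge0 ?ltW//.
rewrite -mulr_natr; field.
by rewrite gt_eqF.
Qed.

(** Positive definiteness of the block of [S] off [s], phrased on full vectors
    so that no submatrices are needed. *)
Definition pd_off s S := forall x, (forall i, i \in s -> tnth x i = 0) ->
  (exists j, tnth x j != 0) -> 0 < qform S x.

Lemma pd_off_diag s S i : pd_off s S -> i \notin s -> 0 < S i i.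
Proof.
move=> pS iS; have := pS (upd [tuple 0 | _ < d] i 1).
have -> : qform S (upd [tuple 0 | _ < d] i 1) = S i i.
  rewrite qformE (bigD1 i)//= [X in _ + X]big1 ?addr0; last first.
    move=> j ji; apply: big1 => k _.
    by rewrite tnth_upd (negbTE ji) tnth_mktuple !mul0r.
  rewrite (bigD1 i)//= big1 ?addr0 ?tnth_upd ?eqxx ?mul1r ?mulr1//.
  by move=> j ji; rewrite (tnth_upd _ _ _ j) (negbTE ji) tnth_mktuple mulr0.
apply; last by exists i; rewrite tnth_upd eqxx oner_eq0.
move=> j js; rewrite tnth_upd tnth_mktuple; case: eqP => // ji.
by rewrite -ji js in iS.
Qed.

(** By [qform_upd], the value of the eliminated form at [x] is the value of the
    original form at [x] with the minimizing coordinate [m] put in place [i]. *)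
Lemma pd_off_elim s S i : S^T = S -> i \notin s -> pd_off s S ->
  pd_off (i :: s) (elim_mx i S).
Proof.
move=> symS iS pS x x0 [j xj].
have Sii : S i i != 0 by rewrite gt_eqF// (pd_off_diag pS).
pose m := tnth x i - (row_of x *m S) 0 i / S i i.
have := @qform_upd S x i m symS Sii; rewrite subrr expr0n mulr0 addr0 => <-.
apply: pS.
  move=> k ks; rewrite tnth_upd; case: eqP => [ki|_].
    by rewrite -ki ks in iS.
  by apply: x0; rewrite inE ks orbT.
exists j; rewrite tnth_upd; case: (j =P i) => // ji; move: xj.
by rewrite ji x0 ?eqxx// mem_head.
Qed.

(** [S'] is the Schur complement of the block of [S] indexed by [s], padded by
    zeros.  The last component expresses that row operations which use the
    rows in [s] only do not change the solutions of the equations in [s]. *)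
Definition schur s S S' := [/\ S'^T = S', pd_off s S',
  forall i j, i \in s -> S' i j = 0 &
  forall y : 'cV[R]_d, (forall i, i \in s -> (S *m y) i 0 = 0) ->
    S' *m y = S *m y].

Lemma schur_elim s S S' i : i \notin s -> schur s S S' ->
  schur (i :: s) S (elim_mx i S').
Proof.
move=> iS [symS pS S0 Sy].
have Sii : S' i i != 0 by rewrite gt_eqF// (pd_off_diag pS).
split; [exact: elim_mx_sym|exact: pd_off_elim| |].
  move=> j k; rewrite inE elim_mxE => /orP[/eqP ->|js].
    by rewrite mulrAC divff// mul1r subrr.
  by rewrite (S0 j k js) (S0 j i js) !mul0r subrr.
move=> y y0; have Sy' : S' *m y = S *m y.
  by apply: Sy => j js; apply: y0; rewrite inE js orbT.
rewrite /elim_mx mulmxBl -scalemxAl -mulmxA -row_mul Sy'.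
have -> : row i (S *m y) = 0.
  by apply/rowP => j; rewrite !ord1 mxE y0 ?mem_head// mxE.
by rewrite mulmx0 scaler0 subr0.
Qed.

(** After completing the square, the variable of integration appears in a factor
    whose integral is the same for all values of the other coordinates. *)
Lemma int1_gform i (k : R) S : 0 < k -> S^T = S -> 0 < S i i ->
  exists2 k', 0 < k' &
    int1 i (EFin \o gform k S) = EFin \o gform k' (elim_mx i S).
Proof.
move=> k0 symS Sii; have [c c0 cE] := integral_gauss_square Sii.
exists (k * c); first exact: mulr_gt0.
apply/funext => x /=.
rewrite /int1 /=; under eq_integral => r _.
  rewrite /gform qform_upd ?gt_eqF// opprD mulrDl expRD mulrA EFinM.
  over.
rewrite ge0_integralZl//=.
- by rewrite cE -EFinM /gform mulrAC.
- apply/measurable_EFinP; apply: measurableT_comp => //.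
  apply: measurable_funM => //; apply: measurableT_comp => //.
  by apply: measurable_funM => //; apply: measurable_funX; apply: measurable_funB.
- by rewrite lee_fin mulr_ge0 ?expR_ge0// ltW.
Qed.

(** Marginals of a Gaussian density are Gaussian, with the Schur complement as
    their precision matrix. *)
Lemma integrate_gform s (k : R) S : uniq s -> 0 < k -> S^T = S -> pd_off [::] S ->
  exists k' S', [/\ 0 < k', schur s S S' &
    integrate s (EFin \o gform k S) = EFin \o gform k' S'].
Proof.
move=> + k0 symS pS; elim: s => [_|i s IH /= /andP[iS us]].
  by exists k, S.
have [k1 [S1 [k10 sS1 ->]]] := IH us.
have [symS1 pS1 _ _] := sS1.
have [k2 k20 ->] := int1_gform k10 symS1 (pd_off_diag pS1 iS).
by exists k2, (elim_mx i S1); split => //; exact: schur_elim.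
Qed.

End gaussian_form.

(** * Conditional probabilities given some coordinates of a random vector *)

(** The density [p] and the Radon-Nikodym derivative of [nu] have the same
    integrals over measurable sets, so they agree almost everywhere, and the
    change of variables formula for the latter transfers to [p]. *)
Lemma integral_density d (T : measurableType d) (R : realType)
    (mu : {sigma_finite_measure set T -> \bar R})
    (nu : {finite_measure set T -> \bar R}) (p : T -> \bar R) :
  measurable_fun setT p ->
  (forall E, measurable E -> nu E = \int[mu]_(x in E) p x)%E ->
  forall f : T -> \bar R, measurable_fun setT f -> (forall x, 0 <= f x)%E ->
  (\int[nu]_x f x = \int[mu]_x (f x * p x))%E.
Proof.
move=> mp nuE f mf f0.
have numu : nu `<< mu.
  apply/null_content_dominatesP => E mE muE.
  by rewrite nuE// null_set_integral//; exact: measurable_funTS.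
rewrite -(Radon_Nikodym_SigmaFinite.change_of_variables numu)//.
have iRN := Radon_Nikodym_SigmaFinite.f_integrable numu.
apply: ae_eq_integral => //.
- by apply: emeasurable_funM => //; exact: measurable_int iRN.
- exact: emeasurable_funM.
apply: ae_eqe_mul2l; apply: integral_ae_eq => // E _ mE.
by rewrite -nuE// (Radon_Nikodym_SigmaFinite.f_integral numu).
Qed.

Section cond_prob_unique.
Context d (T : measurableType d) {R : realType} (P : probability T R).
Variable G : set (set T).
Hypothesis Gm : <<s G >> `<=` measurable.

Lemma measurable_fun_sigma (f : T -> R) :
  (forall B : set R, measurable B -> <<s G >> (f @^-1` B)) ->
  measurable_fun [set: g_sigma_algebraType G] f.
Proof. by move=> fG _ B mB; rewrite setTI; exact: fG. Qed.

(** The set where [f < g] is in the conditioning sigma-algebra, so [f] and [g]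
    have the same integral over it. *)
Let cond_prob_le E (f g : T -> R) : measurable E ->
  is_cond_prob P <<s G >> E f -> is_cond_prob P <<s G >> E g ->
  P [set t | f t < g t] = 0%E.
Proof.
move=> mE [Gf If fE] [Gg Ig gE]; set D := [set t | f t < g t].
have GD : <<s G >> D.
  have -> : D = (g \- f) @^-1` [set` `]0, +oo[].
    by apply/seteqP; split => t; rewrite /D /= in_itv /= andbT subr_gt0.
  have mgf : measurable_fun [set: g_sigma_algebraType G] (g \- f).
    by apply: measurable_funB; exact: measurable_fun_sigma.
  by rewrite -[X in <<s G >> X]setTI; exact: mgf.
have mD := Gm GD.
have IfD : P.-integrable D (EFin \o f) by exact: integrableS If.
have IgD : P.-integrable D (EFin \o g) by exact: integrableS Ig.
have mfg : measurable_fun D (fun t => ((g t)%:E - (f t)%:E)%E).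
  by apply: measurable_int; exact: (integrableB mD IgD IfD).
have : ae_eq P D (fun t => ((g t)%:E - (f t)%:E)%E) (cst 0%E).
  apply/ae_eq_integral_abs => //.
  rewrite (eq_integral (fun t => ((g t)%:E - (f t)%:E)%E)); last first.
    move=> t; rewrite inE /D /= => fg.
    by rewrite -EFinB /= gtr0_norm// subr_gt0.
  rewrite (integralB mD IgD IfD) /= fE// gE// subee//.
  by rewrite fin_num_measure//; exact: measurableI.
move=> [N [mN N0 DN]]; apply/eqP; rewrite -measure_le0 -N0.
apply: le_measure; rewrite ?inE//.
move=> t Dt; apply: DN => /(_ Dt) /= /eqP.
by rewrite -EFinB eqe subr_eq0 gt_eqF.
Qed.

Lemma cond_prob_unique E (f g : T -> R) : measurable E ->
  is_cond_prob P <<s G >> E f -> is_cond_prob P <<s G >> E g ->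
  {ae P, forall t, f t = g t}.
Proof.
move=> mE Hf Hg.
have Gm' (h1 h2 : T -> R) : is_cond_prob P <<s G >> E h1 ->
    is_cond_prob P <<s G >> E h2 -> measurable [set t | h1 t < h2 t].
  move=> [_ /measurable_int/measurable_EFinP m1 _].
  move=> [_ /measurable_int/measurable_EFinP m2 _].
  have -> : [set t | h1 t < h2 t] = (h2 \- h1) @^-1` [set` `]0, +oo[].
    by apply/seteqP; split => t; rewrite /= in_itv /= andbT subr_gt0.
  by rewrite -[X in measurable X]setTI; apply: measurable_funB.
exists ([set t | f t < g t] `|` [set t | g t < f t]); split.
- by apply: measurableU; exact: Gm'.
- by apply: null_set_setU; [exact: Gm'|exact: Gm'|exact: cond_prob_le Hf Hg|
    exact: cond_prob_le Hg Hf].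
- by move=> t /= /eqP; rewrite neq_lt => /orP[|]; [left|right].
Qed.

End cond_prob_unique.

Section sigma_coord.
Context {R : realType} (d : nat) d0 (T : measurableType d0).
Context (P : probability T R) (X : {RV P >-> d.-tuple R}).
Implicit Types (A C : {set 'I_d}) (E D : set (d.-tuple R)).

(** The events expressible by the coordinates in [C]: [sigma_coord X C] consists
    of their preimages under [X] ([sigma_coordP], [cylinder_sigma_coord]). *)
Definition cylinder C E := measurable E /\ depends_on C (E : d.-tuple R -> Prop).

Lemma depends_on_indic C E : cylinder C E ->
  depends_on C (fun x => (\1_E x)%:E : \bar R).
Proof.
move=> [_ dE] x y xy; rewrite /indic; congr (_ (nat_of_bool _))%:E.
by apply/idP/idP; rewrite !in_setE (dE x y xy).
Qed.

(** The preimages of cylinders form a sigma-algebra that contains the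
    generators. *)
Lemma sigma_coordP A (D : set T) : sigma_coord X A D ->
  exists2 E, cylinder A E & D = X @^-1` E.
Proof.
pose H := [set D : set T | exists2 E, cylinder A E & D = X @^-1` E].
suff : sigma_coord X A `<=` H by apply.
apply: smallest_sub => [|B [i iA [J mJ <-]]]; last first.
  exists [set x | J (tnth x i)]; last by rewrite setTI.
  split.
    by rewrite -[X in measurable X]setTI; exact: (@measurable_tnth _ R d i).
  by move=> x y xy; rewrite /= xy.
split.
- by exists set0; [split => //|rewrite preimage_set0].
- move=> B [E [mE dE] ->]; exists (~` E); last by rewrite setTD preimage_setC.
  by split; [exact: measurableC|move=> x y xy; rewrite /setC /= (dE x y xy)].
- move=> F HF.
  have /choice[F' F'P] k : exists E, cylinder A E /\ F k = X @^-1` E.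
    by have [E cE FE] := HF k; exists E.
  exists (\bigcup_k F' k).
    split; first by apply: bigcup_measurable => k _; have [[]] := F'P k.
    move=> x y xy; rewrite /bigcup /mkset; congr (exists2 i, _ & _).
    by apply/funext => k; have [[_ dE] _] := F'P k; rewrite (dE x y xy).
  by rewrite preimage_bigcup; apply: eq_bigcupr => k _; have [] := F'P k.
Qed.

Lemma sigma_coord_measurable A : sigma_coord X A `<=` measurable.
Proof.
move=> D /sigma_coordP[E [mE _] ->].
by rewrite -[X in measurable X]setTI; exact: measurable_funP.
Qed.

(** Resetting the coordinates of [X] outside [C] to 0 gives a vector [Y] that is
    measurable for [sigma_coord X C] and belongs to the cylinder when [X] does. *)
Lemma cylinder_sigma_coord C E : cylinder C E -> sigma_coord X C (X @^-1` E).
Proof.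
move=> [mE dE]; rewrite /sigma_coord; set G := (G in <<s G >>).
pose Y (t : g_sigma_algebraType G) : d.-tuple R :=
  [tuple if i \in C then tnth (X t) i else 0 | i < d].
have mY : measurable_fun [set: g_sigma_algebraType G] Y.
  apply/measurable_fun_tnthP => i; have [iC|iC] := boolP (i \in C).
    rewrite (_ : _ \o _ = fun t => tnth (X t) i); last first.
      by apply/funext => t /=; rewrite tnth_mktuple iC.
    move=> _ B mB; apply: sub_sigma_algebra; exists i => //=.
    by exists B.
  rewrite (_ : _ \o _ = cst 0); first exact: measurable_cst.
  by apply/funext => t /=; rewrite tnth_mktuple (negbTE iC).
have -> : X @^-1` E = Y @^-1` E.
  apply/funext => t; rewrite /preimage /=; apply: dE => i iC.
  by rewrite tnth_mktuple iC.
by rewrite -[X in <<s G >> X]setTI; exact: mY.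
Qed.

End sigma_coord.

Section law_with_density.
Context {R : realType} (d : nat) d0 (T : measurableType d0).
Context (P : probability T R) (X : {RV P >-> d.-tuple R}).
Variable p : d.-tuple R -> R.
Hypothesis mp : measurable_fun setT p.
Hypothesis p_gt0 : forall x, 0 < p x.
Hypothesis p_law : forall E : set (d.-tuple R), measurable E ->
  (distribution P X E = \int[lebesgue_tuple d]_(x in E) (p x)%:E)%E.
Hypothesis p_fin : forall (C : {set 'I_d}) x,
  (integrate (enum C) (EFin \o p) x < +oo)%E.
Implicit Types (A C : {set 'I_d}) (E D : set (d.-tuple R)).

Let pos_p : mpos (EFin \o p).
Proof. by apply: mpos_EFin => // x; exact: ltW. Qed.

Lemma integral_law (f : d.-tuple R -> \bar R) : mpos f ->
  (\int[P]_t f (X t) = \int[lebesgue_tuple d]_x (f x * (p x)%:E))%E.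
Proof.
move=> [mf f0]; rewrite -(ge0_integral_distribution X mf f0).
apply: (integral_density (p := EFin \o p)) => //; exact/measurable_EFinP.
Qed.

(** A factor that depends on [C] only comes out of the inner integral; the
    identities between conditional probabilities reduce to this. *)
Lemma integral_law_setC C (h f : d.-tuple R -> \bar R) x :
  mpos h -> mpos f -> depends_on C h ->
  (\int[P]_t (h (X t) * f (X t)) = integrate (enum C) (fun y => h y *
     integrate (enum (~: C)%SET) (fun z => f z * (p z)%:E) y) x)%E.
Proof.
move=> ph pf dh; have phf := mposM ph pf.
rewrite (integral_law phf) (integral_lebesgue_tuple_setC C x); last exact: mposM.
congr (integrate _ _ x); apply/funext => y.
rewrite -(@integrateZ _ _ _ C)//; first last.
- by move=> i; rewrite mem_enum inE.
- exact: mposM.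
by apply: eq_integrate => z; rewrite muleA.
Qed.

Lemma prob_preimageI C D E x : cylinder C D -> measurable E ->
  (P (X @^-1` E `&` X @^-1` D) = integrate (enum C) (fun y => (\1_D y)%:E *
     integrate (enum (~: C)%SET) (fun z => (\1_E z)%:E * (p z)%:E) y) x)%E.
Proof.
move=> [mD dD] mE; rewrite -preimage_setI.
have mED : measurable (X @^-1` (E `&` D)).
  by rewrite -[X in measurable X]setTI; apply: measurable_funP => //;
    exact: measurableI.
rewrite -integral_law_setC; [|exact: mpos_indic|exact: mpos_indic|
  exact: depends_on_indic].
rewrite -[in LHS](setIT (X @^-1` _)) -(integral_indic P measurableT mED).
apply: eq_integral => t _; rewrite -EFinM !indicE -natrM mulnb.
congr (_%:R%:E); congr nat_of_bool; apply/idP/andP; rewrite !in_setE => -[].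
  by split.
by split.
Qed.

(** The conditional probability of [E] given the coordinates in [C], from the
    quotient of the densities. *)
Definition cond_prob C E x : R :=
  fine (integrate (enum (~: C)%SET) (fun y => (\1_E y)%:E * (p y)%:E)%E x) /
  fine (integrate (enum (~: C)%SET) (EFin \o p) x).

Lemma integrate_indic_le C E x : measurable E ->
  (integrate (enum C) (fun y => (\1_E y)%:E * (p y)%:E) x <=
   integrate (enum C) (EFin \o p) x)%E.
Proof.
move=> mE; apply: le_integrate => //; first exact/mposM/pos_p/mpos_indic.
move=> y; rewrite -EFinM lee_fin; apply: ler_piMl; first exact: ltW.
by rewrite indicE; case: (y \in E).
Qed.

Lemma integrate_indic_fin C E x : measurable E ->
  integrate (enum C) (fun y => (\1_E y)%:E * (p y)%:E)%E x \is a fin_num.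
Proof.
move=> mE; have [_ I0] : mpos (integrate (enum C)
    (fun y => (\1_E y)%:E * (p y)%:E)%E).
  exact/mpos_integrate/mposM/pos_p/mpos_indic.
by rewrite ge0_fin_numE// (le_lt_trans (integrate_indic_le C x mE)).
Qed.

Lemma integrate_p_fin C x : integrate (enum C) (EFin \o p) x \is a fin_num.
Proof. by rewrite ge0_fin_numE//; exact: (mpos_integrate _ pos_p).2. Qed.

Lemma integrate_p_gt0 C x : (0 < integrate (enum C) (EFin \o p) x)%E.
Proof. by apply: integrate_gt0. Qed.

Lemma cond_probE C E x : measurable E ->
  ((cond_prob C E x)%:E * integrate (enum (~: C)%SET) (EFin \o p) x)%E =
  integrate (enum (~: C)%SET) (fun y => (\1_E y)%:E * (p y)%:E)%E x.
Proof.
move=> mE; rewrite -[X in (_ * X)%E]fineK ?integrate_p_fin//.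
rewrite -EFinM divfK ?fineK ?integrate_indic_fin//.
by rewrite gt_eqF// fine_gt0// integrate_p_gt0 p_fin.
Qed.

Lemma cond_prob_ge0 C E x : measurable E -> 0 <= cond_prob C E x.
Proof.
move=> mE; rewrite divr_ge0// fine_ge0//; last first.
  exact/ltW/integrate_p_gt0.
by apply: (mpos_integrate _ _).2; exact/mposM/pos_p/mpos_indic.
Qed.

Lemma cond_prob_le1 C E x : measurable E -> cond_prob C E x <= 1.
Proof.
move=> mE; rewrite ler_pdivrMr ?mul1r.
  by rewrite fine_le ?integrate_indic_fin ?integrate_p_fin ?integrate_indic_le.
by rewrite fine_gt0// integrate_p_gt0 p_fin.
Qed.

Lemma measurable_cond_prob C E : measurable E ->
  measurable_fun setT (cond_prob C E).
Proof.
move=> mE; pose z x := fine (integrate (enum (~: C)%SET) (EFin \o p) x).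
have z0 x : 0 < z x by rewrite fine_gt0// integrate_p_gt0 p_fin.
(* Division by a positive function, written with measurable functions. *)
rewrite (_ : cond_prob C E = fun x =>
    fine (integrate (enum (~: C)%SET) (fun y => (\1_E y)%:E * (p y)%:E)%E x) *
    expR (- ln (z x))); last first.
  by apply/funext => x; rewrite expRN lnK// posrE.
apply: measurable_funM.
  apply: measurableT_comp => //.
  by apply: (mpos_integrate _ _).1; exact/mposM/pos_p/mpos_indic.
apply: measurableT_comp => //; apply: measurableT_comp => //.
apply: measurableT_comp => //; apply: measurableT_comp => //.
exact: (mpos_integrate _ pos_p).1.
Qed.

Lemma depends_on_cond_prob C E : depends_on C (cond_prob C E).
Proof.
have dI (f : d.-tuple R -> \bar R) :
    depends_on C (integrate (enum (~: C)%SET) f).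
  apply: depends_on_integrate => x y xy; congr f; apply: eq_from_tnth => i.
  by apply: xy; rewrite !inE mem_enum inE orNb.
by move=> x y xy; rewrite /cond_prob !(dI _ x y xy).
Qed.

Lemma cylinder_preimage C (f : d.-tuple R -> R) (B : set R) :
  measurable_fun setT f -> depends_on C f -> measurable B ->
  cylinder C (f @^-1` B).
Proof.
move=> mf df mB; split; first by rewrite -[X in measurable X]setTI; exact: mf.
by move=> x y xy; rewrite /preimage /= (df x y xy).
Qed.

Lemma cond_prob_is_cond_prob C E : measurable E ->
  is_cond_prob P (sigma_coord X C) (X @^-1` E) (cond_prob C E \o X).
Proof.
move=> mE; have mc := measurable_cond_prob C mE.
have dc := @depends_on_cond_prob C E.
have pc : mpos (EFin \o cond_prob C E).
  by apply: mpos_EFin => // x; exact: cond_prob_ge0.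
split.
- move=> B mB; rewrite comp_preimage; apply: cylinder_sigma_coord.
  exact: cylinder_preimage.
- apply: measurable_bounded_integrable => //.
  + by rewrite fin_num_fun_lty//; exact: fin_num_measure.
  + by apply: measurableT_comp => //; exact: measurable_funP.
  + exists 1; split => // M M1 t _ /=.
    by rewrite ger0_norm ?cond_prob_ge0// (le_trans (cond_prob_le1 _ _ mE))// ltW.
move=> _ /sigma_coordP[D [mD dD] ->].
have iD := @depends_on_indic _ _ C D (conj mD dD).
have pD := mpos_indic mD.
rewrite (@prob_preimageI C D E [tuple 0 | _ < d])//.
transitivity (\int[P]_t ((\1_D (X t))%:E * (cond_prob C E (X t))%:E))%E.
  rewrite integral_mkcond; apply: eq_integral => t _; rewrite patchE indicE /=.
  have -> : (t \in X @^-1` D) = (X t \in D).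
    by apply/idP/idP; rewrite !in_setE.
  by case: (X t \in D) => /=; rewrite ?mul1e ?mul0e.
rewrite (integral_law_setC [tuple 0 | _ < d] pD pc iD).
apply: eq_integrate => y; congr (_ * _)%E; rewrite -cond_probE//.
apply: (integrateZ _ pos_p pc (depends_on_comp EFin dc)) => i.
by rewrite mem_enum inE.
Qed.

End law_with_density.

(** * The global Markov property *)

Section integrate_product.
Context {R : realType} (d : nat).
Implicit Types (S : {set 'I_d}) (f g : d.-tuple R -> \bar R).

Lemma integrate_setU S1 S2 f : [disjoint S1 & S2]%B -> mpos f ->
  integrate (enum (S1 :|: S2)%SET) f =
  integrate (enum S1) (integrate (enum S2) f).
Proof.
move=> S12 pf; rewrite -integrate_cat; apply: perm_integrate => //.
apply: uniq_perm; first exact: enum_uniq.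
  rewrite cat_uniq !enum_uniq /= andbT; apply/hasPn => i.
  by rewrite !mem_enum => iS; rewrite (disjointFl S12).
by move=> i; rewrite mem_cat !mem_enum inE.
Qed.

(** [f] is constant for the integration over [S2], and then the integral of [g]
    is constant for the integration over [S1]. *)
Lemma integrate_product S1 S2 f g x : [disjoint S1 & S2]%B ->
  mpos f -> mpos g -> depends_on (~: S2)%SET f -> depends_on (~: S1)%SET g ->
  integrate (enum (S1 :|: S2)%SET) (fun y => f y * g y)%E x =
  (integrate (enum S1) f x * integrate (enum S2) g x)%E.
Proof.
move=> S12 pf pg df dg; rewrite integrate_setU//; last exact: mposM.
rewrite (@eq_integrate _ _ _ _
    (fun y => integrate (enum S2) g y * f y)%E); last first.
  move=> y; rewrite muleC; apply: (integrateZ _ pg pf df) => i.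
  by rewrite mem_enum inE negbK.
rewrite muleC; apply: (@integrateZ _ _ _ (~: S1)%SET) => //.
- exact: mpos_integrate.
- apply: depends_on_integrate; apply: depends_onS dg.
  by apply/fintype.subsetP => i; rewrite !inE => ->; rewrite orbT.
- by move=> i; rewrite mem_enum inE negbK.
Qed.

End integrate_product.

Section factorization.
Context {R : realType} (d : nat) d0 (T : measurableType d0).
Context (P : probability T R) (X : {RV P >-> d.-tuple R}).
Variable p : d.-tuple R -> R.
Hypothesis mp : measurable_fun setT p.
Hypothesis p_gt0 : forall x, 0 < p x.
Hypothesis p_law : forall E : set (d.-tuple R), measurable E ->
  (distribution P X E = \int[lebesgue_tuple d]_(x in E) (p x)%:E)%E.
Hypothesis p_fin : forall (C : {set 'I_d}) x,
  (integrate (enum C) (EFin \o p) x < +oo)%E.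

(** Every integral over the coordinates outside [C] that occurs in the
    conditional probabilities is a product of an integral of [u] over [A'] and
    one of [v] over [B'], whence the product formula holds at every point. *)
Lemma cond_indep_factor (A B C A' B' : {set 'I_d}) (u v : d.-tuple R -> R) :
  measurable_fun setT u -> measurable_fun setT v ->
  (forall x, 0 < u x) -> (forall x, 0 < v x) -> p = (fun x => u x * v x) ->
  (~: C = A' :|: B')%SET -> [disjoint A' & B']%B ->
  depends_on (~: B')%SET u -> depends_on (~: A')%SET v ->
  A \subset A' -> B \subset B' ->
  cond_indep P (sigma_coord X A) (sigma_coord X B) (sigma_coord X C).
Proof.
move=> mu mv u0 v0 pE CE AB' du dv AA' BB'.
move=> _ _ /sigma_coordP[E1 [mE1 dE1] ->] /sigma_coordP[E2 [mE2 dE2] ->].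
exists (cond_prob p C E1 \o X), (cond_prob p C E2 \o X),
  (cond_prob p C (E1 `&` E2) \o X).
have mE12 := measurableI _ _ mE1 mE2.
split; [exact: cond_prob_is_cond_prob|exact: cond_prob_is_cond_prob| |].
  by rewrite -preimage_setI; exact: cond_prob_is_cond_prob.
apply: aeW => t /=; move: (X t) => x {t}.
have pu : mpos (EFin \o u) by apply: mpos_EFin => // y; exact/ltW.
have pv : mpos (EFin \o v) by apply: mpos_EFin => // y; exact/ltW.
pose I1 f := integrate (enum A') f x; pose I2 f := integrate (enum B') f x.
pose e1 y : \bar R := (\1_E1 y)%:E; pose e2 y : \bar R := (\1_E2 y)%:E.
have pe1 : mpos e1 by exact: mpos_indic.
have pe2 : mpos e2 by exact: mpos_indic.
have de1 : depends_on (~: B')%SET e1.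
  apply: (depends_onS _ (depends_on_indic (conj mE1 dE1))).
  apply: (fintype.subset_trans AA'); rewrite -finset.disjoints_subset.
  exact: AB'.
have de2 : depends_on (~: A')%SET e2.
  apply: (depends_onS _ (depends_on_indic (conj mE2 dE2))).
  apply: (fintype.subset_trans BB'); rewrite -finset.disjoints_subset disjoint_sym.
  exact: AB'.
have ItE (f g : d.-tuple R -> \bar R) (h : d.-tuple R -> \bar R) :
    mpos f -> mpos g -> depends_on (~: B')%SET f -> depends_on (~: A')%SET g ->
    h = (fun y => f y * g y)%E ->
    integrate (enum (~: C)%SET) h x = (I1 f * I2 g)%E.
  by move=> pf pg df dg ->; rewrite CE; exact: integrate_product.
have du' := depends_on_comp EFin du; have dv' := depends_on_comp EFin dv.
have deu := depends_on2 (fun a b => a * b)%E de1 du'.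
have dev := depends_on2 (fun a b => a * b)%E de2 dv'.
pose J E := integrate (enum (~: C)%SET) (fun y => (\1_E y)%:E * (p y)%:E)%E x.
have J12 : J (E1 `&` E2) = (I1 (fun y => e1 y * (EFin \o u) y) *
    I2 (fun y => e2 y * (EFin \o v) y))%E.
  apply: ItE (mposM pe1 pu) (mposM pe2 pv) deu dev _; apply/funext => y.
  rewrite /e1 /e2 /= pE /= -!EFinM !indicE in_setI -mulnb natrM.
  by congr EFin; ring.
have J1 : J E1 = (I1 (fun y => e1 y * (EFin \o u) y) * I2 (EFin \o v))%E.
  apply: ItE (mposM pe1 pu) pv deu dv' _; apply/funext => y.
  by rewrite /e1 /= pE /= -!EFinM mulrA.
have J2 : J E2 = (I1 (EFin \o u) * I2 (fun y => e2 y * (EFin \o v) y))%E.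
  apply: ItE pu (mposM pe2 pv) du' dev _; apply/funext => y.
  by rewrite /e2 /= pE /= -!EFinM mulrCA.
have J0 : integrate (enum (~: C)%SET) (EFin \o p) x =
    (I1 (EFin \o u) * I2 (EFin \o v))%E.
  by apply: ItE pu pv du' dv' _; apply/funext => y; rewrite /= pE.
rewrite /cond_prob -/(J _) -/(J _) -/(J _) J12 J1 J2 J0.
have Ip := p_fin (~: C)%SET x; rewrite J0 in Ip.
(* The two factors are positive with a finite product, hence both finite. *)
have a0 : (0 < I1 (EFin \o u))%E by apply: integrate_gt0.
have b0 : (0 < I2 (EFin \o v))%E by apply: integrate_gt0.
have a1le : (I1 (fun y => e1 y * (EFin \o u) y) <= I1 (EFin \o u))%E.
  exact: integrate_indic_le.
have b1le : (I2 (fun y => e2 y * (EFin \o v) y) <= I2 (EFin \o v))%E.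
  exact: integrate_indic_le.
have a1ge := (mpos_integrate (enum A') (mposM pe1 pu)).2 x.
have b1ge := (mpos_integrate (enum B') (mposM pe2 pv)).2 x.
move: Ip a0 b0 a1le b1le a1ge b1ge; rewrite -/(I1 _) -/(I2 _).
move: (I1 _) (I2 _) (I1 _) (I2 _) => a1 b1 a b.
case: a => [a| |]//; case: b => [b| |]//; last 2 first.
- by move=> + a0; rewrite gt0_muley.
- by move=> + _ b0; rewrite gt0_mulye.
move=> _; rewrite !lte_fin => a0 b0.
case: a1 => [a1| |]//; case: b1 => [b1| |]// _ _ _ _.
by rewrite -!EFinM /=; field; rewrite !gt_eqF.
Qed.

End factorization.

Section global_markov.
Context {R : realType} (d : nat) (G : rel 'I_d).
Variables (k : R) (K : 'M[R]_d).
Hypotheses (k_gt0 : 0 < k) (symK : K^T = K) (pdK : pd_off [::] K).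
Hypothesis K0 : forall i j, i != j -> ~~ G i j -> K i j = 0.

Lemma gform_fin (C : {set 'I_d}) x :
  (integrate (enum C) (EFin \o gform k K) x < +oo)%E.
Proof.
have [k' [S' [_ _ ->]]] := integrate_gform (enum_uniq C) k_gt0 symK pdK.
exact: ltry.
Qed.

(** The quadratic form of [K] splits as the part that involves a coordinate in
    [B], given by [mxon B], and the rest. *)
Let mxon (B : {set 'I_d}) : 'M[R]_d :=
  \matrix_(i, j) if (i \in B) || (j \in B) then K i j else 0.

Let mxon_sym B : (mxon B)^T = mxon B.
Proof. by apply/matrixP => i j; rewrite !mxE orbC -{1}symK mxE. Qed.

(** The global Markov property: since [C] separates, no edge joins the vertices
    [A'] reachable from [A] off [C] to the remaining vertices [B'] off [C], so
    [K] vanishes on [A' x B'] and the density factors. *)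
Lemma separates_cond_indep (A B C : {set 'I_d}) d0 (T : measurableType d0)
    (P : probability T R) (X : {RV P >-> d.-tuple R}) :
  (forall E : set (d.-tuple R), measurable E ->
    (distribution P X E = \int[lebesgue_tuple d]_(x in E) (gform k K x)%:E)%E) ->
  [disjoint A & B]%B -> [disjoint A & C]%B -> [disjoint B & C]%B ->
  separates G C A B ->
  cond_indep P (sigma_coord X A) (sigma_coord X B) (sigma_coord X C).
Proof.
move=> law dAB dAC dBC sep.
pose e : rel 'I_d := [rel i j | [&& G i j, i \notin C & j \notin C]].
pose A' : {set 'I_d} := [set v | [exists a in A, connect e a v]]%SET.
pose B' : {set 'I_d} := (~: (A' :|: C))%SET.
have AA' : A \subset A'.
  by apply/fintype.subsetP => a aA; rewrite inE; apply/existsP; exists a;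
    rewrite aA connect0.
have A'C : [disjoint A' & C]%B.
  apply/pred0Pn => -[v /andP[]]; rewrite /= inE => /existsP[a /andP[aA]].
  case/connectP => q; case/lastP: q => [_ ->|q w].
    by rewrite (disjointFr dAC).
  rewrite rcons_path last_rcons => /andP[_ /and3P[_ _ wC]] -> vC.
  by rewrite vC in wC.
have BB' : B \subset B'.
  apply/fintype.subsetP => b bB; rewrite !inE negb_or (disjointFr dBC bB) andbT.
  apply/existsP => -[a /andP[aA /connectP[q]]].
  (* Removing the loops of a walk from [a] to [b] gives a path off [C]. *)
  case/shortenP => q' pq' uq' _ bE.
  have pG : path G a q' by apply: sub_path pq' => i j /andP[].
  have := sep _ _ pG uq' aA; rewrite -bE => /(_ bB) /hasP[v vq vC].
  have : all [predC C] (a :: q').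
    rewrite /= (disjointFr dAC aA) /=.
    elim: q' a {bE uq' pG vq aA} pq' => //= w q' IH a /andP[/and3P[_ _ ->]].
    exact: IH.
  by move=> /allP /(_ v vq) /negP; apply.
have AB0 i j : i \in A' -> j \in B' -> K i j = 0.
  rewrite !inE negb_or => iA /andP[jA jC].
  have ij : i != j.
    by apply: contra jA => /eqP <-.
  apply: K0 => //; apply: contra jA => Gij.
  case/existsP: (iA) => a /andP[aA ai]; apply/existsP; exists a; rewrite aA /=.
  apply: connect_trans ai (connect1 _); rewrite /e /= Gij jC andbT /=.
  by rewrite (disjointFr A'C)// inE.
pose u := gform k (K - mxon B'); pose v := gform 1 (mxon B').
apply: (@cond_indep_factor _ _ _ _ _ _ (gform k K) _ _ law _ A B C A' B' u v).
- exact: measurable_gform.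
- by move=> x; exact: gform_gt0.
- exact: gform_fin.
- exact: measurable_gform.
- exact: measurable_gform.
- by move=> x; exact: gform_gt0.
- by move=> x; exact: gform_gt0.
- apply/funext => x; rewrite /u /v /gform mul1r -mulrA -expRD.
  by rewrite -mulrDl -opprD -qformD subrK.
- apply/setP => i; rewrite !inE negb_or; have [iC|iC] := boolP (i \in C).
    rewrite andbF orbF; apply/esym/negbTE.
    by have := disjointFl A'C iC; rewrite inE => ->.
  by rewrite andbT orbN.
- apply/pred0P => i /=; rewrite [i \in B']inE finset.in_setU.
  by case: (i \in A').
- apply: depends_on_gform => [|i j].
    by rewrite linearB /= symK mxon_sym.
  by rewrite inE negbK => iB; rewrite !mxE iB subrr.
- apply: depends_on_gform => [|i j]; first exact: mxon_sym.
  rewrite inE negbK => iA; rewrite mxE.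
  have [jB|jB] := boolP (j \in B'); first by rewrite orbT AB0.
  by rewrite inE inE iA.
- exact: AA'.
- exact: BB'.
Qed.

End global_markov.

(** * Continuous functions are determined by their integrals over boxes *)

Section boxes.
Context {R : realType} (d : nat).
Implicit Types (x y z : d.-tuple R) (s : seq 'I_d) (S : 'M[R]_d).

Definition box s x (e : R) : set (d.-tuple R) :=
  [set y | forall i, i \in s -> ball (tnth x i) e (tnth y i)].

Lemma cylinder_ball i (a e : R) :
  cylinder [set i]%SET [set y : d.-tuple R | ball a e (tnth y i)].
Proof.
split.
  rewrite -[X in measurable X]setTI.
  exact: (@measurable_tnth _ R d i _ _ (measurable_ball a e)).
by move=> y z yz; rewrite /= yz// inE.
Qed.

Lemma cylinder_box s x (e : R) : cylinder [set i in s]%SET (box s x e).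
Proof.
elim: s => [|i s [mB dB]].
  split; last by move=> y z _; apply/propext; split.
  by rewrite (_ : box _ _ _ = setT)//; apply/seteqP; split.
have [mi di] := cylinder_ball i (tnth x i) e.
have E : box (i :: s) x e =
    [set y : d.-tuple R | ball (tnth x i) e (tnth y i)] `&` box s x e.
  apply/seteqP; split => [y Hy|y [/= Hi Hy] j].
    by split => [|j js] /=; apply: Hy; rewrite inE ?eqxx ?js ?orbT.
  by rewrite inE => /predU1P[->//|]; exact: Hy.
rewrite E; split; first exact: measurableI.
move=> y z yz; rewrite /setI /=; congr (_ /\ _).
  by rewrite yz// !inE eqxx.
by apply: dB => j; rewrite !inE => js; apply: yz; rewrite !inE js orbT.
Qed.

Lemma indic_boxS i s x (e : R) y : \1_(box (i :: s) x e) y =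
  \1_([set y : d.-tuple R | ball (tnth x i) e (tnth y i)]) y *
  \1_(box s x e) y :> R.
Proof.
rewrite !indicE -natrM mulnb; congr (_%:R); congr nat_of_bool.
apply/idP/andP; rewrite !in_setE.
  by move=> Hy; split => [|j js] /=; apply: Hy; rewrite inE ?eqxx ?js ?orbT.
by move=> [/= Hi Hy] j; rewrite inE => /predU1P[->//|]; exact: Hy.
Qed.

Lemma integrate_box s x (e : R) z : uniq s -> 0 <= e ->
  integrate s (fun y => (\1_(box s x e) y)%:E) z = ((e *+ 2) ^+ size s)%:E.
Proof.
move=> + e0; elim: s z => [z _|i s IH z /= /andP[iS us]].
  by rewrite /= indicE expr0 mem_set.
have ci := cylinder_ball i (tnth x i) e.
have cs := cylinder_box s x e.
set J := [set y : d.-tuple R | ball (tnth x i) e (tnth y i)] in ci.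
rewrite (_ : (fun y => _) = (fun y => (\1_J y)%:E * (\1_(box s x e) y)%:E)%E);
  last first.
  by apply/funext => y; rewrite indic_boxS EFinM.
rewrite /int1; under eq_integral => r _.
  rewrite (@integrateZ _ _ s [set i]%SET (fun y => (\1_J y)%:E)
    (fun y => (\1_(box s x e) y)%:E)).
  - rewrite IH// muleC.
    over.
  - exact: mpos_indic cs.1.
  - exact: mpos_indic ci.1.
  - exact: depends_on_indic.
  - by move=> j js; rewrite inE; apply: contra iS => /eqP <-.
rewrite ge0_integralZl//; last 2 first.
- exact: (mpos_upd z i (mpos_indic ci.1)).
- by rewrite lee_fin exprn_ge0// mulrn_wge0.
have -> : (\int[lebesgue_measure]_r (\1_J (upd z i r))%:E = (e *+ 2)%:E)%E.
  transitivity (\int[lebesgue_measure]_r (\1_(ball (tnth x i) e) r)%:E)%E.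
    apply: eq_integral => r _; congr (_ (nat_of_bool _))%:E.
    by apply/idP/idP; rewrite !in_setE /J /= tnth_upd eqxx.
  rewrite integral_indic//; last exact: measurable_ball.
  rewrite setIT; exact: lebesgue_measure_ball.
by rewrite -EFinM exprSr.
Qed.

Definition box_continuous (f : d.-tuple R -> R) := forall x (e : R), 0 < e ->
  exists2 r : R, 0 < r & forall y, box (enum 'I_d) x r y -> `|f x - f y| < e.

(** If [g x < f x], then on a small box around [x] the function [f] stays above
    f x - e and [g] below g x + e < f x - e, so the integrals over that box
    differ.  Boxes restrict the coordinates in [s] only, because those are the
    coordinates over which the functions are integrated. *)
Lemma eq_of_integrate_box s (f g : d.-tuple R -> R) : uniq s ->
  mpos (EFin \o f) -> mpos (EFin \o g) ->
  depends_on [set i in s]%SET f -> depends_on [set i in s]%SET g ->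
  box_continuous f -> box_continuous g ->
  (forall x (r : R) z, 0 < r ->
    integrate s (fun y => (\1_(box s x r) y)%:E * (f y)%:E)%E z =
    integrate s (fun y => (\1_(box s x r) y)%:E * (g y)%:E)%E z) ->
  f = g.
Proof.
move=> us pf pg df dg cf cg fg; apply/funext => x.
have [pmf f0] := pf; have [pmg g0] := pg.
wlog lt_gf : f g pf pg pmf pmg f0 g0 df dg cf cg fg / g x < f x.
  move=> W; case: (ltgtP (f x) (g x)) => [lt_fg|lt_gf|//]; last exact: W.
  by apply/esym/W => // y r z r0; rewrite fg.
exfalso; pose e := (f x - g x) / 3.
have e0 : 0 < e by rewrite divr_gt0// subr_gt0.
have [r1 r10 Hf] := cf x e e0; have [r2 r20 Hg] := cg x e e0.
pose r := Num.min r1 r2; have r0 : 0 < r by rewrite lt_min r10.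
have near h : depends_on [set i in s]%SET h -> forall y, box s x r y ->
    exists2 y', box (enum 'I_d) x r y' & (h y' : R) = h y.
  move=> dh y Hy; exists [tuple if i \in s then tnth y i else tnth x i | i < d].
    move=> i _; rewrite tnth_mktuple; case: ifP => [|_]; first exact: Hy.
    exact: ballxx.
  by apply: dh => i; rewrite inE tnth_mktuple => ->.
have boxW (r' : R) y : r <= r' -> box (enum 'I_d) x r y -> box (enum 'I_d) x r' y.
  by move=> rr' Hy i iS; apply: le_ball (Hy i iS).
have fge y : box s x r y -> f x - e <= f y.
  move=> /(near f df)[y' By' <-].
  have /Hf : box (enum 'I_d) x r1 y' by apply: boxW By'; rewrite ge_min lexx.
  by rewrite ltr_distlC => /andP[/ltW].
have gle y : box s x r y -> g y <= g x + e.
  move=> /(near g dg)[y' By' <-].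
  have /Hg : box (enum 'I_d) x r2 y'.
    by apply: boxW By'; rewrite ge_min lexx orbT.
  by rewrite ltr_distlC => /andP[_ /ltW].
have [mB dB] := cylinder_box s x r; have pB := mpos_indic mB.
have gx0 : 0 <= g x by have := g0 x; rewrite /= lee_fin.
have ge0 : 0 <= g x + e by apply: addr_ge0 => //; exact: ltW.
have fe0 : 0 <= f x - e by rewrite /e; lra.
have cst_pos (c : R) : 0 <= c -> mpos (fun _ : d.-tuple R => c%:E).
  by move=> c0; apply: mpos_cst; rewrite lee_fin.
have int_cst (c : R) : 0 <= c ->
    integrate s (fun y => c%:E * (\1_(box s x r) y)%:E)%E x =
    (c * (r *+ 2) ^+ size s)%:E.
  move=> c0; rewrite EFinM -(integrate_box x x us (ltW r0)).
  apply: (@integrateZ _ _ _ finset.set0 (fun=> c%:E)) => // i _.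
  by rewrite inE.
suff : (((f x - e) * (r *+ 2) ^+ size s)%:E <=
    ((g x + e) * (r *+ 2) ^+ size s)%:E)%E.
  rewrite lee_fin ler_pM2r ?exprn_gt0 ?mulrn_wgt0//.
  by rewrite /e; lra.
rewrite -!int_cst//.
apply: (@le_trans _ _ (integrate s
  (fun y => (\1_(box s x r) y)%:E * (f y)%:E)%E x)).
  apply: le_integrate; [exact/mposM/pB/cst_pos|exact: mposM|move=> y].
  rewrite -!EFinM lee_fin indicE; case: (boolP (y \in _)); last first.
    by rewrite mulr0 mul0r.
  by rewrite in_setE mulr1 mul1r => /fge.
rewrite fg//; apply: le_integrate; [exact: mposM|exact/mposM/pB/cst_pos|move=> y].
rewrite -!EFinM lee_fin indicE; case: (boolP (y \in _)); last first.
  by rewrite mulr0 mul0r.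
by rewrite in_setE mulr1 mul1r => /gle.
Qed.

Lemma box_continuous_gform (k : R) S : box_continuous (gform k S).
Proof.
move=> x e e0; pose q (v : 'rV[R]_d) := \sum_i \sum_j v 0 i * S i j * v 0 j.
pose F v := k * expR (- q v / 2).
have FE y : gform k S y = F (row_of y).
  rewrite /gform qformE /F.
  suff -> : q (row_of y) = \sum_i \sum_j tnth y i * S i j * tnth y j by [].
  by apply: eq_bigr => i _; apply: eq_bigr => j _; rewrite !mxE.
have cq : continuous q.
  apply: continuous_big => [|i _]; first exact: add_continuous.
  apply: continuous_big => [|j _]; first exact: add_continuous.
  move=> w; apply: (@continuousM R _ (fun v : 'rV[R]_d => v 0 i * S i j)
    (fun v : 'rV[R]_d => v 0 j) w); last exact: coord_continuous.
  apply: (@continuousM R _ (fun v : 'rV[R]_d => v 0 i) (cst (S i j)) w).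
    exact: coord_continuous.
  exact: cst_continuous.
have cF : continuous F.
  move=> v; apply: (@continuousM R _ (cst k) (fun v => expR (- q v / 2)) v).
    exact: cst_continuous.
  apply: (@continuous_comp _ _ _ (fun v => - q v / 2) expR v); last first.
    exact: continuous_expR.
  apply: (@continuousM R _ (fun v => - q v) (cst 2^-1) v); last first.
    exact: cst_continuous.
  by apply: continuousN; exact: cq.
have /cvgrPdist_lt /(_ e e0) /nbhs_ballP[r /= r0 Hr] := cF (row_of x).
exists r => // y Hy; rewrite !FE; apply: Hr.
split=> // i j; rewrite !mxE; apply: Hy; exact: mem_enum.
Qed.

End boxes.

(** * Conditional independence forces an algebraic relation *)

Section gform_injective.
Context {R : realType} (d : nat).

(** Polarization. *)
Lemma qform_eq0 (S : 'M[R]_d) : S^T = S -> qform S =1 (fun=> 0) -> S = 0.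
Proof.
move=> symS S0; pose B i j := (delta_mx 0 i *m S *m (delta_mx 0 j)^T : 'M[R]_1) 0 0.
have BE i j : B i j = S i j.
  by rewrite /B trmx_delta -rowE -colE !mxE.
have Q (v : 'rV[R]_d) : (v *m S *m v^T) 0 0 = 0.
  have := S0 [tuple v 0 i | i < d]; rewrite /qform.
  have -> // : row_of [tuple v 0 i | i < d] = v.
  by apply/rowP => i; rewrite mxE tnth_mktuple.
apply/matrixP => i j; rewrite [RHS]mxE.
have := Q (delta_mx 0 i + delta_mx 0 j).
have D (M N : 'M[R]_1) : (M + N) 0 0 = M 0 0 + N 0 0 by rewrite mxE.
rewrite linearD /= !mulmxDl !mulmxDr !D.
rewrite -!/(B _ _) !BE.
have := Q (delta_mx 0 i); rewrite -/(B i i) BE => ->.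
have := Q (delta_mx 0 j); rewrite -/(B j j) BE => ->.
rewrite -{2}symS mxE; lra.
Qed.

Lemma gform_inj (k1 k2 : R) (S1 S2 : 'M[R]_d) : 0 < k1 -> 0 < k2 ->
  S1^T = S1 -> S2^T = S2 -> gform k1 S1 = gform k2 S2 -> S1 = S2.
Proof.
move=> k10 k20 sym1 sym2 E.
have q0 (S : 'M[R]_d) : qform S [tuple 0 | _ < d] = 0.
  by rewrite qformE big1// => i _; rewrite big1// => j _;
    rewrite !tnth_mktuple !mul0r.
have k12 : k1 = k2.
  have := congr1 (fun f => f [tuple 0 | _ < d]) E.
  by rewrite /gform !q0 oppr0 mul0r expR0 !mulr1.
apply/eqP; rewrite -subr_eq0; apply/eqP; apply: qform_eq0.
  by rewrite linearB /= sym1 sym2.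
move=> x; have := congr1 (fun f => f x) E.
rewrite /gform k12 => /(mulfI (lt0r_neq0 k20)) /expR_inj; rewrite qformD qformN.
lra.
Qed.

End gform_injective.

(** A full-size stand-in for the block of [K] off [C]: for [a] and [b] outside
    [C], its adjugate has the same entry at (a, b) as that of the block. *)
Definition mask_mx (R : nzRingType) d (C : {set 'I_d}) (K : 'M[R]_d) : 'M[R]_d :=
  \matrix_(i, j) if (i \in C) || (j \in C) then (i == j)%:R else K i j.

Section cond_indep_algebraic.
Context {R : realType} (d : nat).
Variables (k : R) (K : 'M[R]_d).
Hypotheses (k_gt0 : 0 < k) (symK : K^T = K) (pdK : pd_off [::] K).
Context d0 (T : measurableType d0) (P : probability T R).
Variable X : {RV P >-> d.-tuple R}.
Hypothesis law : forall E : set (d.-tuple R), measurable E ->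
  (distribution P X E = \int[lebesgue_tuple d]_(x in E) (gform k K x)%:E)%E.
Variables (A B C : {set 'I_d}) (a b : 'I_d).
Hypotheses (aA : a \in A) (bB : b \in B) (ab : a != b)
  (aC : a \notin C) (bC : b \notin C).
Hypothesis CI : cond_indep P (sigma_coord X A) (sigma_coord X B) (sigma_coord X C).

Let p := gform k K.
Let mp : measurable_fun setT p := measurable_gform k K.
Let p_gt0 x : 0 < p x := gform_gt0 K x k_gt0.
Let p_fin := gform_fin k_gt0 symK pdK.
Let pos_p : mpos (EFin \o p) := mpos_gform K k_gt0.

Let perm_setCU1 c (D : {set 'I_d}) : c \notin D ->
  perm_eq (enum (~: D)%SET) (c :: enum (~: (c |: D))%SET).
Proof.
move=> cD; apply: uniq_perm; first exact: enum_uniq.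
  by rewrite /= enum_uniq mem_enum !inE eqxx.
move=> i; rewrite inE !mem_enum !inE negb_or.
by case: (i =P c) => [->|].
Qed.

(** Both sides are the probability that [X] is in [E1], [E2] and [D]: the left
    one by integrating the density, the right one by integrating over [D] the
    conditional probability, which is the product of those of [E1] and [E2]. *)
Let product_boxes (J1 J2 : set R) (D : set (d.-tuple R)) x :
  measurable J1 -> measurable J2 -> cylinder C D ->
  let E1 := [set y : d.-tuple R | J1 (tnth y a)] in
  let E2 := [set y : d.-tuple R | J2 (tnth y b)] in
  integrate (enum C) (fun y => (\1_D y)%:E *
    integrate (enum (~: C)%SET) (fun z => (\1_(E1 `&` E2) z)%:E * (p z)%:E) y)%E x =
  integrate (enum C) (fun y => (\1_D y)%:E *
    ((cond_prob p C E1 y)%:E * ((cond_prob p C E2 y)%:E *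
     integrate (enum (~: C)%SET) (EFin \o p) y)))%E x.
Proof.
move=> mJ1 mJ2 cD E1 E2.
have mE1 : measurable E1.
  by rewrite -[X in measurable X]setTI; exact: (@measurable_tnth _ R d a).
have mE2 : measurable E2.
  by rewrite -[X in measurable X]setTI; exact: (@measurable_tnth _ R d b).
have sE (c : 'I_d) (J : set R) (F : {set 'I_d}) : measurable J -> c \in F ->
    sigma_coord X F (X @^-1` [set y : d.-tuple R | J (tnth y c)]).
  by move=> mJ cF; apply: sub_sigma_algebra; exists c => //; exists J => //;
    rewrite setTI.
have [f1 [f2 [f12 [c1 c2 c12 f12E]]]] := CI (sE a J1 A mJ1 aA) (sE b J2 B mJ2 bB).
have GX := @sigma_coord_measurable _ _ _ _ _ X C.
have mX E : measurable E -> measurable (X @^-1` E).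
  by move=> mE; rewrite -[X in measurable X]setTI; exact: measurable_funP.
have g1 := cond_prob_unique GX (mX _ mE1) c1
  (cond_prob_is_cond_prob mp p_gt0 law p_fin C mE1).
have g2 := cond_prob_unique GX (mX _ mE2) c2
  (cond_prob_is_cond_prob mp p_gt0 law p_fin C mE2).
have mE12 := measurableI _ _ mE1 mE2.
have mc E := measurable_cond_prob mp p_gt0 p_fin C (E := E).
have pc E : measurable E -> mpos (EFin \o cond_prob p C E).
  by move=> mE; apply: mpos_EFin; [exact: mc|move=> y; exact: cond_prob_ge0].
rewrite -(prob_preimageI mp p_gt0 law x cD mE12) preimage_setI.
have [_ /measurable_int mf12 f12I] := c12.
rewrite -(f12I _ (cylinder_sigma_coord cD)).
have pc12 := mposM (pc _ mE1) (pc _ mE2).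
transitivity (\int[P]_t ((\1_D (X t))%:E *
   ((cond_prob p C E1 (X t))%:E * (cond_prob p C E2 (X t))%:E)))%E.
  rewrite integral_mkcond; apply: ae_eq_integral => //.
  - by apply: (measurable_restrictT _ (mX _ cD.1)).1; exact: measurable_funTS.
  - have [mDc _] := mposM (mpos_indic cD.1) pc12.
    by apply: (measurableT_comp mDc); exact: measurable_funP.
  apply: filterS3 f12E g1 g2 => t e12 e1 e2 _.
  rewrite patchE indicE /=.
  have -> : (t \in X @^-1` D) = (X t \in D).
    by apply/idP/idP; rewrite !in_setE.
  by case: (X t \in D) => /=; rewrite ?mul1e ?mul0e// e12 e1 e2 EFinM.
rewrite (integral_law_setC mp p_gt0 law x (mpos_indic cD.1) pc12
  (depends_on_indic cD)).
apply: eq_integrate => y; congr (_ * _)%E; rewrite muleA.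
apply: (@integrateZ _ _ _ C) => //.
- by apply: depends_on2; apply: depends_on_comp; exact: depends_on_cond_prob.
- by move=> i; rewrite mem_enum inE.
Qed.

Let U := (a |: (b |: C))%SET.

Let perm_setCU : perm_eq (enum (~: C)%SET) [:: a, b & enum (~: U)%SET].
Proof.
apply: uniq_perm; first exact: enum_uniq.
  by rewrite /= enum_uniq !inE !mem_enum !inE !eqxx orbT negb_or ab.
move=> i; rewrite !inE !mem_enum !inE !negb_or.
by case: (i =P a) => [->|_] //=; case: (i =P b) => [->|].
Qed.

(** The joint density of the coordinates in [U] is the product of the
    densities on [a |: C] and on [b |: C] divided by the density on [C].  The
    matrices [S2], [S3] and [S4] of these densities have entry 0 at (a, b),
    hence so has [S1]. *)
Let schur_entry0 S1 (k1 : R) : 0 < k1 -> schur (enum (~: U)%SET) K S1 ->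
  integrate (enum (~: U)%SET) (EFin \o p) = EFin \o gform k1 S1 -> S1 a b = 0.
Proof.
move=> k10 sS1 hE; have [sym1 _ S10 _] := sS1.
have [k2 [S2 [k20 [sym2 _ S20 _] paE]]] :=
  integrate_gform (enum_uniq (~: (a |: C))%SET) k_gt0 symK pdK.
have [k3 [S3 [k30 [sym3 _ S30 _] pbE]]] :=
  integrate_gform (enum_uniq (~: (b |: C))%SET) k_gt0 symK pdK.
have [k4 [S4 [k40 [sym4 _ S40 _] zE]]] :=
  integrate_gform (enum_uniq (~: C)%SET) k_gt0 symK pdK.
rewrite -/p in paE pbE zE.
have sE (D : {set 'I_d}) (S : 'M[R]_d) :
    (forall i j, i \in enum (~: D)%SET -> S i j = 0) ->
    forall i j, i \notin D -> S i j = 0.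
  by move=> S0 i j iD; apply: S0; rewrite mem_enum inE.
have symg : (S2 + S3 - S4)^T = S2 + S3 - S4.
  by rewrite linearB linearD /= sym2 sym3 sym4.
pose g := gform (k2 * k3 / k4) (S2 + S3 - S4).
have kg0 : 0 < k2 * k3 / k4 by rewrite divr_gt0// mulr_gt0.
pose zinv := gform k4^-1 (- S4).
have k4V0 : 0 < k4^-1 by rewrite invr_gt0.
have gE y : g y = zinv y * (gform k2 S2 y * gform k3 S3 y).
  rewrite /g /zinv /gform !qformD !qformN.
  have -> : - (qform S2 y + qform S3 y - qform S4 y) / 2 =
    - - qform S4 y / 2 + (- qform S2 y / 2 + - qform S3 y / 2) by field.
  by rewrite !expRD; field; rewrite gt_eqF.
have zV y : zinv y * gform k4 S4 y = 1.
  rewrite /zinv /gform mulrACA -expRD qformN mulVf ?gt_eqF// mul1r.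
  by rewrite -mulrDl opprK subrr mul0r expR0.
(* [g] is the quotient of densities above, and [zinv] the inverse of the density on [C]. *)
suff gh : gform k1 S1 = g.
  rewrite (gform_inj k10 kg0 sym1 symg gh) !mxE.
  have -> : S2 a b = S2 b a by rewrite -{1}sym2 mxE.
  rewrite (sE _ _ S20) ?(sE _ _ S30) ?(sE _ _ S40)//.
  - by rewrite addr0 subr0.
  - by rewrite !inE negb_or ab.
  - by rewrite !inE negb_or eq_sym ab.
pose s := enum C ++ [:: a; b].
have sU : [set i in s]%SET = U.
  apply/setP => i; rewrite !inE mem_cat mem_enum !inE.
  by case: (i \in C); rewrite ?orbT ?orbF.
have us : uniq s.
  rewrite cat_uniq enum_uniq /= !inE andbT ab orbF negb_or !mem_enum.
  by rewrite aC bC.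
have sC : [set i in enum C]%SET = C by apply/setP => i; rewrite inE mem_enum.
have subU (D : {set 'I_d}) : D \subset U -> forall i, i \notin U -> i \notin D.
  by move=> /fintype.subsetP DU i; apply: contra => /DU.
have sub2 : (a |: C)%SET \subset U.
  by apply/fintype.subsetP => i; rewrite !inE => /orP[->|->]; rewrite ?orbT.
have sub3 : (b |: C)%SET \subset U.
  by apply/fintype.subsetP => i; rewrite !inE => ->; rewrite orbT.
have sub4 : C \subset U by apply/fintype.subsetP => i; rewrite !inE => ->; rewrite !orbT.
apply: (eq_of_integrate_box us).
- exact: mpos_gform.
- exact: mpos_gform.
- rewrite sU; apply: depends_on_gform => //; exact: sE.
- rewrite sU; apply: depends_on_gform => // i j iU; rewrite !mxE.
  rewrite (sE _ _ S20) ?(sE _ _ S30) ?(sE _ _ S40) ?(subU _ sub2) ?(subU _ sub3) ?(subU _ sub4)//.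
  by rewrite addr0 subr0.
- exact: box_continuous_gform.
- exact: box_continuous_gform.
move=> x r y0 r0.
pose E1 := [set y : d.-tuple R | ball (tnth x a) r (tnth y a)].
pose E2 := [set y : d.-tuple R | ball (tnth x b) r (tnth y b)].
pose D := box (enum C) x r.
have cD : cylinder C D by have := cylinder_box (enum C) x r; rewrite sC.
have c1 : cylinder [set a]%SET E1 := cylinder_ball _ _ _.
have c2 : cylinder [set b]%SET E2 := cylinder_ball _ _ _.
have boxE y : (\1_(box s x r) y)%:E =
    ((\1_D y)%:E * ((\1_E1 y)%:E * (\1_E2 y)%:E))%E :> \bar R.
  rewrite -!EFinM !indicE -!natrM !mulnb; congr (_%:R%:E); congr nat_of_bool.
  apply/idP/and3P; rewrite !in_setE.
    by move=> Hy; split; [move=> i iC|..]; apply: Hy;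
      rewrite mem_cat !inE ?iC ?eqxx ?orbT.
  move=> [HD H1 H2] i; rewrite mem_cat !inE => /or3P[|/eqP ->|/eqP ->] //.
  exact: HD.
have := product_boxes y0 (measurable_ball (tnth x a) r)
  (measurable_ball (tnth x b) r) cD.
rewrite -/E1 -/E2 => PB.
have pD := mpos_indic cD.1; have p1 := mpos_indic c1.1; have p2 := mpos_indic c2.1.
have p12 := mposM p1 p2.
have iD := depends_on_indic cD.
have fact f : mpos f -> integrate s (fun y => (\1_(box s x r) y)%:E * f y)%E y0 =
    integrate (enum C) (fun y => (\1_D y)%:E *
      integrate [:: a; b] (fun z => (\1_E1 z)%:E * (\1_E2 z)%:E * f z) y)%E y0.
  move=> pf; rewrite integrate_cat; apply: eq_integrate => y.
  rewrite -(@integrateZ _ _ [:: a; b] C (fun y => (\1_D y)%:E)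
    (fun z => (\1_E1 z)%:E * (\1_E2 z)%:E * f z)%E y (mposM p12 pf) pD iD).
    by apply: eq_integrate => z; rewrite boxE -!muleA.
  by move=> i; rewrite !inE => /orP[] /eqP ->.
rewrite !fact; [|exact: mpos_gform|exact: mpos_gform].
have left y : integrate (enum (~: C)%SET)
      (fun z => (\1_(E1 `&` E2) z)%:E * (p z)%:E)%E y =
    integrate [:: a; b] (fun z => (\1_E1 z)%:E * (\1_E2 z)%:E *
      (EFin \o gform k1 S1) z)%E y.
  have pE12 := mposM (mpos_indic (measurableI _ _ c1.1 c2.1)) pos_p.
  rewrite (perm_integrate pE12 perm_setCU) -[a :: _]/([:: a; b] ++ _).
  rewrite integrate_cat -hE; apply: eq_integrate => z.
  rewrite -(@integrateZ _ _ _ [set a; b]%SET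
    (fun z => (\1_E1 z)%:E * (\1_E2 z)%:E)%E (EFin \o p) z pos_p p12).
  - apply: eq_integrate => w; rewrite -!EFinM !indicE in_setI -mulnb natrM.
    by rewrite mulrA.
  - by apply: depends_on2; [apply: depends_onS (depends_on_indic c1)|
      apply: depends_onS (depends_on_indic c2)]; apply/fintype.subsetP => i;
      rewrite !inE => ->; rewrite ?orbT.
  - move=> i; rewrite mem_enum !inE !negb_or => /andP[-> /andP[-> _]].
    by [].
have cpE c (E : set (d.-tuple R)) (kc : R) (S : 'M[R]_d) y : c \notin C ->
    cylinder [set c]%SET E -> 0 < kc ->
    integrate (enum (~: (c |: C))%SET) (EFin \o p) = EFin \o gform kc S ->
    ((cond_prob p C E y)%:E * (EFin \o gform k4 S4) y)%E =
    int1 c (fun z => (\1_E z)%:E * (gform kc S z)%:E)%E y.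
  move=> cC cE kc0 E'; rewrite -zE cond_probE//; last exact: cE.1.
  rewrite (perm_integrate (s2 := c :: enum (~: (c |: C))%SET)); last 2 first.
  - exact: mposM (mpos_indic cE.1) pos_p.
  - exact: perm_setCU1.
  congr (int1 c _ y); apply/funext => z; rewrite -[(gform kc S z)%:E]/((EFin \o gform kc S) z).
  rewrite -E'; apply: (integrateZ _ pos_p (mpos_indic cE.1) (depends_on_indic cE)) => i.
  by rewrite mem_enum !inE negb_or => /andP[].
have right y : ((cond_prob p C E1 y)%:E * ((cond_prob p C E2 y)%:E *
      integrate (enum (~: C)%SET) (EFin \o p) y))%E =
    integrate [:: a; b] (fun z => (\1_E1 z)%:E * (\1_E2 z)%:E * (EFin \o g) z)%E y.
  pose u1 z := ((\1_E1 z)%:E * (gform k2 S2 z)%:E)%E : \bar R.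
  pose u2 z := ((\1_E2 z)%:E * (gform k3 S3 z)%:E)%E : \bar R.
  have pu1 : mpos u1 by apply: mposM p1 (mpos_gform _ _).
  have pu2 : mpos u2 by apply: mposM p2 (mpos_gform _ _).
  have pzi : mpos (EFin \o zinv) by exact: mpos_gform.
  have dzi : depends_on C (EFin \o zinv).
    apply: depends_on_comp; apply: depends_on_gform => [|i j iC].
      by rewrite linearN /= sym4.
    by rewrite mxE (sE _ _ S40) ?oppr0.
  have du1 : depends_on (a |: C)%SET u1.
    apply: (depends_on2 (fun s t => s * t)%E).
      apply: depends_onS (depends_on_indic c1); apply/fintype.subsetP => i.
      by rewrite !inE => ->.
    by apply: depends_on_comp; apply: depends_on_gform => //; exact: sE.
  have du2 : depends_on (b |: C)%SET u2.
    apply: (depends_on2 (fun s t => s * t)%E).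
      apply: depends_onS (depends_on_indic c2); apply/fintype.subsetP => i.
      by rewrite !inE => ->.
    by apply: depends_on_comp; apply: depends_on_gform => //; exact: sE.
  have dV : depends_on C (int1 b u2) by exact: depends_on_int1.
  have dzu1 : depends_on (a |: C)%SET (fun z => (EFin \o zinv) z * u1 z)%E.
    apply: (depends_on2 (fun s t => s * t)%E) => //.
    by apply: depends_onS dzi; apply/fintype.subsetP => i; rewrite !inE => ->;
      rewrite orbT.
  have E w : int1 b (fun z => (\1_E1 z)%:E * (\1_E2 z)%:E * (EFin \o g) z)%E w =
      ((EFin \o zinv) w * int1 b u2 w * u1 w)%E.
    transitivity (integrate [:: b] (fun z => (EFin \o zinv) z * u1 z * u2 z)%E w).
      apply: (@eq_integrate _ _ [:: b]) => z; rewrite /u1 /u2 /= gE -!EFinM; congr EFin; ring.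
    rewrite (integrateZ _ pu2 (mposM pzi pu1) dzu1) /=; last first.
      by move=> i; rewrite !inE => /eqP ->; rewrite negb_or eq_sym ab.
    by rewrite muleAC.
  rewrite /= (_ : int1 b _ = (fun w => (EFin \o zinv) w * int1 b u2 w * u1 w)%E);
    last by apply/funext => w; exact: E.
  have := @integrateZ _ _ [:: a] C (fun w => (EFin \o zinv) w * int1 b u2 w)%E
    u1 y pu1 (mposM pzi (mpos_int1 b pu2)) (depends_on2 (fun s t => s * t)%E dzi dV).
  move=> /= ->; last by move=> i; rewrite inE => /eqP ->.
  rewrite -(cpE a E1 k2 S2 y aC c1 k20 paE) -(cpE b E2 k3 S3 y bC c2 k30 pbE).
  rewrite zE /= -!EFinM; congr EFin.
  rewrite -[LHS]mulr1 -(zV y); ring.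
transitivity (integrate (enum C) (fun y => (\1_D y)%:E *
    integrate (enum (~: C)%SET) (fun z => (\1_(E1 `&` E2) z)%:E * (p z)%:E) y)%E y0).
  by apply: eq_integrate => y; rewrite left.
by rewrite PB; apply: eq_integrate => y; rewrite right.
Qed.

(** Let [y] be the column [b] of the adjugate.  It vanishes on [C], and [K *m y]
    vanishes outside [C] except at [b]; hence [K *m y] and [S1 *m y] agree.  The
    entry [a] of [S1 *m y] is 0, and it reduces to [S1 a a * y a] as [S1 a b]
    is 0. *)
Lemma cond_indep_adj0 : (\adj (mask_mx C K)) a b = 0.
Proof.
have [k1 [S1 [k10 sS1 hE]]] := integrate_gform (enum_uniq (~: U)%SET) k_gt0 symK pdK.
have Sab := schur_entry0 k10 sS1 hE.
have [sym1 pd1 S10 S1y] := sS1.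
set N := mask_mx C K; pose y := col b (\adj N).
have Ny i : (N *m y) i 0 = \det N *+ (i == b).
  have /matrixP/(_ i b) := mul_mx_adj N; rewrite [RHS]mxE => <-.
  by rewrite [LHS]mxE [RHS]mxE; apply: eq_bigr => j _; rewrite [y _ _]mxE.
have yC c : c \in C -> y c 0 = 0.
  move=> cC; have := Ny c; rewrite (_ : c == b = false); last first.
    by apply: contraNF bC => /eqP <-.
  rewrite mxE (bigD1 c)//= big1 => [|j jc]; rewrite mxE cC ?eqxx.
    by rewrite mul1r addr0.
  by rewrite eq_sym (negbTE jc) mul0r.
have Ky i : i \notin C -> (K *m y) i 0 = (N *m y) i 0.
  move=> iC; rewrite !mxE; apply: eq_bigr => j _; rewrite [N _ _]mxE (negbTE iC) /=.
  by case: ifP => // jC; rewrite yC ?mulr0.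
have Sy : S1 *m y = K *m y.
  apply: S1y => i; rewrite mem_enum !inE !negb_or => /and3P[_ ib iC].
  by rewrite Ky// Ny (negbTE ib).
have Saa : 0 < S1 a a.
  by apply: (pd_off_diag pd1); rewrite mem_enum !inE eqxx.
have : (S1 *m y) a 0 = 0 by rewrite Sy Ky// Ny (negbTE ab).
rewrite mxE (bigD1 a)//= big1 => [|j ja].
  by rewrite addr0 [y _ _]mxE => /eqP; rewrite mulf_eq0 gt_eqF//= => /eqP.
have [->|jb] := eqVneq j b; first by rewrite Sab mul0r.
have [jC|jC] := boolP (j \in C); first by rewrite yC// mulr0.
have -> : S1 a j = S1 j a by rewrite -{1}sym1 mxE.
by rewrite S10 ?mul0r// mem_enum !inE !negb_or ja jb.
Qed.

End cond_indep_algebraic.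

(** * Zero sets of polynomial functions *)

Section polynomial_functions.
Context {R : realType}.

(** The polynomial functions of n variables, given by how they are built:
    measurability, the restriction to a section and the polynomial dependence on
    one variable all follow by induction. *)
Inductive polyfun n : (n.-tuple R -> R) -> Prop :=
| polyfun_cst c : polyfun (fun=> c)
| polyfun_coord i : polyfun (fun t => tnth t i)
| polyfun_add f g : polyfun f -> polyfun g -> polyfun (fun t => f t + g t)
| polyfun_mul f g : polyfun f -> polyfun g -> polyfun (fun t => f t * g t).

Lemma polyfun_sum n (I : Type) (r : seq I) (F : I -> n.-tuple R -> R) :
  (forall i, polyfun (F i)) -> polyfun (fun t => \sum_(i <- r) F i t).
Proof.
move=> pF; elim: r => [|i r IH].
  by under eq_fun do rewrite big_nil; exact: polyfun_cst.
by under eq_fun do rewrite big_cons; exact: polyfun_add.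
Qed.

Lemma polyfun_prod n (I : Type) (r : seq I) (F : I -> n.-tuple R -> R) :
  (forall i, polyfun (F i)) -> polyfun (fun t => \prod_(i <- r) F i t).
Proof.
move=> pF; elim: r => [|i r IH].
  by under eq_fun do rewrite big_nil; exact: polyfun_cst.
by under eq_fun do rewrite big_cons; exact: polyfun_mul.
Qed.

Lemma polyfun_det n m (M : n.-tuple R -> 'M[R]_m) :
  (forall i j, polyfun (fun t => M t i j)) -> polyfun (fun t => \det (M t)).
Proof.
move=> pM; apply: polyfun_sum => s; apply: polyfun_mul; first exact: polyfun_cst.
by apply: polyfun_prod => i; exact: pM.
Qed.

Lemma polyfun_adj n m (M : n.-tuple R -> 'M[R]_m) :
  (forall i j, polyfun (fun t => M t i j)) ->
  forall i j, polyfun (fun t => (\adj (M t)) i j).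
Proof.
move=> pM i j; under eq_fun do rewrite mxE /cofactor.
apply: polyfun_mul; first exact: polyfun_cst.
by apply: polyfun_det => k l; under eq_fun do rewrite !mxE; exact: pM.
Qed.

Lemma measurable_polyfun n (f : n.-tuple R -> R) :
  polyfun f -> measurable_fun setT f.
Proof.
elim=> {f} [c|i|f g _ mf _ mg|f g _ mf _ mg].
- exact: measurable_cst.
- exact: measurable_tnth.
- exact: measurable_funD.
- exact: measurable_funM.
Qed.

Lemma polyfun_tcons n (f : n.+1.-tuple R -> R) r :
  polyfun f -> polyfun (fun t => f (tcons (r, t))).
Proof.
elim=> {f} [c|i|f g _ pf _ pg|f g _ pf _ pg].
- exact: polyfun_cst.
- case: (unliftP ord0 i) => [j ->|->]; last exact: polyfun_cst.
  by under eq_fun do rewrite tnth_tconsS; exact: polyfun_coord.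
- exact: polyfun_add.
- exact: polyfun_mul.
Qed.

Lemma polyfun_tcons_poly n (f : n.+1.-tuple R -> R) t :
  polyfun f -> exists q : {poly R}, forall r, f (tcons (r, t)) = q.[r].
Proof.
elim=> {f} [c|i|f g _ [p pE] _ [q qE]|f g _ [p pE] _ [q qE]].
- by exists c%:P => r; rewrite hornerC.
- case: (unliftP ord0 i) => [j ->|->].
    by exists (tnth t j)%:P => r; rewrite hornerC tnth_tconsS.
  by exists 'X => r; rewrite hornerX.
- by exists (p + q) => r; rewrite hornerD pE qE.
- by exists (p * q) => r; rewrite hornerM pE qE.
Qed.

Lemma finite_roots (q : {poly R}) : q != 0 -> finite_set [set r | root q r].
Proof.
move=> q0; apply: contrapT => /(infinite_set_fset (size q))[B BQ].
apply/negP; rewrite -ltnNge; apply: max_poly_roots => //; last exact: finmap.fset_uniq.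
by apply/allP => r rB; exact: BQ.
Qed.

(** By Fubini's theorem, as for all but finitely many values of the first
    coordinate the polynomial in the other coordinates is not identically 0. *)
Lemma polyfun_null n (f : n.-tuple R -> R) : polyfun f ->
  (exists t, f t != 0) -> lebesgue_tuple n [set t | f t = 0] = 0%E.
Proof.
elim: n f => [|n IH] f pf [t0 ft0].
  rewrite (_ : [set t | f t = 0] = set0) ?measure0//.
  by apply/seteqP; split => // t; rewrite /= (tuple0 t) -(tuple0 t0); apply/eqP.
have mZ m (g : m.-tuple R -> R) : polyfun g -> measurable [set t | g t = 0].
  move=> /measurable_polyfun mg.
  by rewrite -[X in measurable X]setTI; exact: (mg measurableT _ (measurable_set1 0)).
have mZf := mZ _ _ pf.
rewrite -[in LHS](setIT [set t | f t = 0]) -(integral_indic _ measurableT mZf).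
rewrite integral_tcons; last exact: mpos_indic.
have [q qE] := polyfun_tcons_poly [tuple of behead t0] pf.
have q0 : q != 0.
  apply: contraNneq ft0 => q0.
  by rewrite (tcons_tuple_eta t0) qE q0 horner0.
have mF := measurable_fun_fubini_tonelli_F (m2 := lebesgue_tuple n)
  (fun p : measurableTypeR R * n.-tuple R => (\1_[set t | f t = 0] (tcons p))%:E).
rewrite (ae_eq_integral (cst 0%E)) ?integral0//.
- apply: mF => [|p]; last by rewrite lee_fin.
  by apply: (measurableT_comp (mpos_indic mZf).1); exact: measurable_tcons.
exists [set r | root q r]; split.
- exact/countable_measurable/finite_set_countable/finite_roots.
- exact/countable_lebesgue_measure0/finite_set_countable/finite_roots.
move=> r; rewrite /=; apply: contra_notP => /negP qr _.
have mZr := mZ _ _ (polyfun_tcons r pf).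
rewrite -[RHS](IH _ (polyfun_tcons r pf)); last first.
  by exists [tuple of behead t0]; rewrite qE.
rewrite -[in RHS](setIT [set t | f (tcons (r, t)) = 0]) -(integral_indic _ measurableT mZr).
by [].
Qed.

End polynomial_functions.

(** * Generic matrices supported on a graph *)

Section minimum_principle.
Context {R : realFieldType} (d : nat) (N : 'M[R]_d).
Hypothesis N_le0 : forall i j, i != j -> N i j <= 0.
Hypothesis N_sum : forall i, 0 < \sum_j N i j.

(** At a negative minimum [m] of [z] one has
    (N z)_m <= (sum of the row m of N) * z_m < 0. *)
Lemma minimum_principle (z : 'cV[R]_d) :
  (forall i, 0 <= (N *m z) i 0) -> forall i, 0 <= z i 0.
Proof.
move=> Nz i; rewrite leNgt; apply/negP => zi.
have [m _ /= mmin] := @Order.TotalTheory.arg_minP _ _ _ i xpredT (fun i => z i 0) isT.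
have zm : z m 0 < 0 by apply: le_lt_trans zi; exact: mmin.
have := Nz m; rewrite leNgt => /negP; apply.
apply: (@le_lt_trans _ _ ((\sum_j N m j) * z m 0)); last by rewrite nmulr_llt0.
rewrite mxE mulr_suml; apply: ler_sum => j _.
have [->//|mj] := eqVneq m j.
by apply: ler_wnM2l; [exact: N_le0|exact: mmin].
Qed.

Lemma minimum_principle_det : N^T = N -> \det N != 0.
Proof.
move=> symN; apply/det0P => -[v v0 vN].
have Nz : N *m v^T = 0 by rewrite -[N]symN -trmx_mul vN trmx0.
have z0 i : (v^T) i 0 = 0.
  apply/eqP; rewrite eq_le; apply/andP; split.
    rewrite -oppr_ge0; have := @minimum_principle (- v^T) _ i.
    by rewrite mxE; apply => j; rewrite mulmxN Nz oppr0 mxE.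
  by apply: minimum_principle => j; rewrite Nz mxE.
by move/eqP: v0; apply; apply/rowP => i; have := z0 i; rewrite !mxE.
Qed.

(** The column [z] of the inverse is nonnegative.  At a zero of [z] the vector
    [N *m z] is a sum of nonpositive terms, so a zero at [a] would propagate
    along the path to [b], where [N *m z] is 1. *)
Lemma minimum_principle_adj a q : N^T = N ->
  path (fun i j => N i j < 0) a q -> (\adj N) a (last a q) != 0.
Proof.
move=> symN; set b := last a q => pq.
have detN := minimum_principle_det symN.
pose z : 'cV[R]_d := (\det N)^-1 *: col b (\adj N).
have Nz i : (N *m z) i 0 = (i == b)%:R.
  rewrite -scalemxAr mxE.
  have -> : (N *m col b (\adj N)) i 0 = (N *m \adj N) i b.
    by rewrite !mxE; apply: eq_bigr => j _; rewrite [col _ _ _ _]mxE.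
  by rewrite mul_mx_adj mxE -[\det N *+ _]mulr_natr mulKf.
have z0 : forall i, 0 <= z i 0.
  by apply: minimum_principle => i; rewrite Nz ler0n.
have sum_le0 x (Q : pred 'I_d) : \sum_(j | (j != x) && Q j) N x j * z j 0 <= 0.
  apply: sumr_le0 => j /andP[jx _]; apply: mulr_le0_ge0 (z0 j).
  by apply: N_le0; rewrite eq_sym.
have NzE x : z x 0 = 0 -> \sum_(j | j != x) N x j * z j 0 = (x == b)%:R.
  by move=> zx; rewrite -Nz mxE [RHS](bigD1 x)//= zx mulr0 add0r.
suff : z a 0 != 0 by apply: contra => /eqP ab; rewrite mxE [col _ _ _ _]mxE ab mulr0.
have : last a q = b by [].
move: b z Nz z0 sum_le0 NzE => b z _ z0 sum_le0 NzE.
elim: q a pq => [|y q IH] x /= pq lb; apply/negP => /eqP zx.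
  have := sum_le0 x xpredT; under eq_bigl do rewrite andbT.
  by rewrite NzE// lb eqxx ler10.
case/andP: pq => xy pq; have zy := IH _ pq lb.
have yx : y != x by apply: contraNneq zy => ->; exact/eqP.
have := NzE x zx; rewrite (bigD1 y)//= => Ex.
have : N x y * z y 0 < 0 by rewrite nmulr_rlt0// lt_def zy z0.
have := sum_le0 x (fun j => j != y).
have : 0 <= (x == b)%:R :> R by rewrite ler0n.
by rewrite -Ex; lra.
Qed.

End minimum_principle.

Section supported_matrices.
Context {R : realType} (d : nat) (G : rel 'I_d).
Hypotheses (Gsym : symmetric G) (Girr : irreflexive G).
Implicit Types (A : 'M[R]_d) (t : (#|edges G| + d).-tuple R).

Let edge_of (i j : 'I_d) := if (i < j)%N then (i, j) else (j, i).

(** Inverse to [coordinates] on the symmetric matrices supported on [G]. *)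
Definition mx_of t : 'M[R]_d := \matrix_(i, j)
  if i == j then tnth t (rshift _ i)
  else if [pick k : 'I_#|edges G| | enum_val k == edge_of i j] is Some k
    then tnth t (lshift d k) else 0.

Lemma mx_of_coordinates A : A^T = A ->
  (forall i j, i != j -> ~~ G i j -> A i j = 0) -> mx_of (coordinates G A) = A.
Proof.
move=> symA A0; apply/matrixP => i j; rewrite mxE.
have [<-|ij] := eqVneq i j; first by rewrite tnth_rshift tnth_mktuple.
case: pickP => [k /eqP kE|noedge].
  rewrite tnth_lshift tnth_mktuple kE /edge_of; case: ifP => //= _.
  by rewrite -{1}symA mxE.
apply/esym/A0 => //; apply/negP => Gij.
have eE : edge_of i j \in edges G.
  rewrite inE /edge_of; case: ifP => [ltij|/negbT] /=; first by rewrite ltij.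
  by rewrite -leqNgt leq_eqVlt val_eqE (eq_sym j) (negbTE ij) Gsym Gij andbT.
by have := noedge (enum_rank_in eE (edge_of i j)); rewrite enum_rankK_in// eqxx.
Qed.

Lemma polyfun_mask (C : {set 'I_d}) i j :
  polyfun (fun t => mask_mx C (mx_of t) i j).
Proof.
under eq_fun do rewrite mxE.
case: ((i \in C) || (j \in C)); first exact: polyfun_cst.
under eq_fun do rewrite mxE.
case: (i == j); first exact: polyfun_coord.
by case: [pick k | _] => [k|]; [exact: polyfun_coord|exact: polyfun_cst].
Qed.

(** The vanishing of this minor is what conditional independence of the
    coordinates [a] and [b] given those in [C] amounts to. *)
Definition minor_fun (C : {set 'I_d}) (a b : 'I_d) t : R :=
  (\adj (mask_mx C (mx_of t))) a b.

(* The diagonal exceeds all degrees, so row sums stay positive after masking. *)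
Let wit : 'M[R]_d := \matrix_(i, j) if i == j then d.+1%:R else - (G i j)%:R.

Lemma minor_fun_neq0 (C : {set 'I_d}) a q : path G a q ->
  {in a :: q, forall v, v \notin C} ->
  minor_fun C a (last a q) (coordinates G wit) != 0.
Proof.
move=> pq qC; rewrite /minor_fun mx_of_coordinates; last 2 first.
- by apply/matrixP => i j; rewrite !mxE eq_sym Gsym.
- by move=> i j ij Gij; rewrite mxE (negbTE ij) (negbTE Gij) oppr0.
apply: minimum_principle_adj => [i j ij|i||].
- rewrite mxE; case: ifP => _; first by rewrite (negbTE ij).
  by rewrite mxE (negbTE ij) oppr_le0 ler0n.
- have [iC|iC] := boolP (i \in C).
    rewrite (bigD1 i)//= big1 ?addr0 ?mxE ?iC ?eqxx//.
    by move=> j ji; rewrite mxE iC eq_sym (negbTE ji).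
  have sE : \sum_j (d.+2%:R *+ (j == i) - 1 : R) = 2.
    rewrite sumrB sumr_const card_ord (bigD1 i)//= eqxx big1 => [|j /negbTE ->//].
    by rewrite addr0 mulr1n -natrB ?subSn ?subnn// ltnW.
  apply: (@lt_le_trans _ _ 2); first by rewrite ltr0n.
  rewrite -sE; apply: ler_sum => j _; rewrite !mxE (negbTE iC) /= eq_sym.
  have [<-|ij] := eqVneq i j; first by rewrite (negbTE iC) mulr1n -natr1 addrK.
  rewrite mulr0n sub0r; case: ifP => _; first by rewrite oppr_le0 ler01.
  by rewrite lerN2 lern1 leq_b1.
- by apply/matrixP => i j; rewrite !mxE orbC (eq_sym j i) Gsym.
- elim: q a pq qC => //= y q IH a /andP[Gay pq] qC; apply/andP; split.
    have aC : a \notin C by apply: qC; rewrite mem_head.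
    have yC : y \notin C by apply: qC; rewrite !inE eqxx orbT.
    rewrite !mxE (negbTE aC) (negbTE yC) /=; case: eqP => [ay|_].
      by rewrite ay Girr in Gay.
    by rewrite Gay ltrN10.
  by apply: IH => // v vq; apply: qC; rewrite inE vq orbT.
Qed.

End supported_matrices.

(** * Perfectness of generic Markovian matrices *)

Lemma positive_definite_pd_off (R : realType) d (A : 'M[R]_d) :
  positive_definite A -> pd_off [::] A.
Proof.
move=> [_ pA] x _ [j xj]; apply: pA; apply/eqP => /rowP /(_ j).
by rewrite !mxE => xj0; rewrite xj0 eqxx in xj.
Qed.

Lemma gaussian_pdfE (R : realType) d (A : 'M[R]_d) :
  gaussian_pdf (invmx A) =
  gform (Num.sqrt ((2 * pi) ^+ d * \det (invmx A)))^-1 A.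
Proof. by apply/funext => x; rewrite /gaussian_pdf invmxK. Qed.

(** The normalizing constant is positive because a Gaussian law has mass 1. *)
Lemma gaussian_law_gform (R : realType) d (A : 'M[R]_d) d0
    (T : measurableType d0) (P : probability T R) (X : {RV P >-> d.-tuple R}) :
  is_gaussian X (invmx A) -> exists2 k, 0 < k &
    forall E : set (d.-tuple R), measurable E ->
    (distribution P X E = \int[lebesgue_tuple d]_(x in E) (gform k A x)%:E)%E.
Proof.
rewrite /is_gaussian gaussian_pdfE; set k := _^-1 => law; exists k => //.
rewrite lt_def invr_ge0 sqrtr_ge0 andbT; apply/eqP => k0.
have := law _ measurableT; rewrite probability_setT.
under eq_integral do rewrite /gform k0 mul0r.
by rewrite integral0 => /eqP; rewrite onee_eq0.
Qed.

Theorem theorem1 (R : realType) (d : nat) (G : rel 'I_d)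
    (Gsym : symmetric G) (Girr : irreflexive G) :
  (lebesgue_tuple (#|edges G| + d)).-negligible
    (coordinates G @` [set A : 'M[R]_d |
       [/\ positive_definite A, markovian G (invmx A) &
           ~ perfect G (invmx A)]]).
Proof.
(* Triples ((a, b), C) whose minor vanishes identically contribute nothing. *)
pose F (i : 'I_d * 'I_d * {set 'I_d}) : set ((#|edges G| + d).-tuple R) :=
  if `[< exists t, minor_fun (G := G) i.2 i.1.1 i.1.2 t != 0 :> R >]
  then [set t | minor_fun i.2 i.1.1 i.1.2 t = 0] else set0.
have F0 i : (lebesgue_tuple (#|edges G| + d)).-negligible (F i).
  rewrite /F; case: asboolP => [ex|_]; last exact: negligible_set0.
  have pf : polyfun (minor_fun (R := R) (G := G) i.2 i.1.1 i.1.2).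
    by apply: polyfun_adj => j k; exact: polyfun_mask.
  apply/negligibleP; last exact: polyfun_null.
  rewrite -[X in measurable X]setTI.
  exact: (measurable_polyfun pf measurableT (measurable_set1 0)).
apply: (negligibleS (A := \bigcup_k oapp F set0 (unpickle k))); last first.
  apply: negligible_bigcup => k.
  by case: (unpickle k) => [i|] /=; [exact: F0|exact: negligible_set0].
move=> _ [A [pdA [_ marA] nperf] <-].
apply: contrapT => notF; apply: nperf.
have symA := pdA.1; have pA := positive_definite_pd_off pdA.
have A0 i j : i != j -> ~~ G i j -> A i j = 0.
  move=> ij Gij; apply/eqP; have := marA i j ij; rewrite invmxK => AG.
  by apply: contraNT Gij => Aij; rewrite -AG.
have minor0 a b C : (exists t, minor_fun (G := G) C a b t != 0 :> R) ->
    minor_fun (G := G) C a b (coordinates G A) != 0.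
  move=> ex; apply/eqP => m0; apply: notF; exists (pickle (a, b, C)) => //.
  by rewrite pickleK /= /F /= asboolT.
move=> d0 T P X /gaussian_law_gform[k k0 law] SA SB C dAB dAC dBC _ _.
split; first exact: (separates_cond_indep k0 symA pA A0 law).
move=> CI x q pq uq xA qB; apply: contrapT => /negP /hasPn qC.
have xC : x \notin C by rewrite (disjointFr dAC xA).
have bC : last x q \notin C by rewrite (disjointFr dBC qB).
have ab : x != last x q.
  by apply/eqP => e; have := disjointFr dAB xA; rewrite e qB.
have := cond_indep_adj0 k0 symA pA law xA qB ab xC bC CI.
apply/eqP; have := minor0 x (last x q) C; rewrite /minor_fun mx_of_coordinates//.
apply; eexists; apply: minor_fun_neq0 => //.
Qed.
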